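(* Let $d=2^n$. Let $A,B,C,D$ be $n$-qubit Pauli operators with $A,B,C,D\ne I$, $AC\neq I$ and $BD\ne I$. Then the Haar average of the commutator-type eight-point out-of-time-order correlator satisfies, as $d\to\infty$, $$\langle A\tilde BC\tilde DA^\dagger\tilde D^\dagger C^\dagger\tilde B^\dagger\rangle_{\mathrm{Haar}}=O(d^{-4}),$$ regardless of the commutation relations among $A,C$ and among $B,D$ (i.e. with an implied constant independent of $n$ and of the choice of such $A,B,C,D$).
   Context: $n$-qubit Pauli operators are the $4^n=d^2$ operators $P_1\otimes\cdots\otimes P_n$ with each $P_j\in\{I,X,Y,Z\}$ (no global phases). With $\tilde O=U^\dagger OU$, the Haar average is $\langle A\tilde BC\tilde DA^\dagger\tilde D^\dagger C^\dagger\tilde B^\dagger\rangle_{\mathrm{Haar}}=\int_{\mathrm{Haar}}dU\,\frac1d\mathrm{tr}\{A\tilde BC\tilde DA^\dagger\tilde D^\dagger C^\dagger\tilde B^\dagger\}$, with $dU$ the Haar probability measure on $U(d)$. *)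

(* Defs.v *)
From HB Require Import structures.
From mathcomp Require Import all_boot all_order all_algebra.
From mathcomp Require Import complex mxtens.
From mathcomp Require Import all_classical all_reals all_analysis.

Set Implicit Arguments.
Unset Strict Implicit.
Unset Printing Implicit Defensive.

Import Order.TTheory GRing.Theory Num.Theory.
Import numFieldNormedType.Exports.

Local Open Scope classical_set_scope.
Local Open Scope ring_scope.
Local Open Scope complex_scope.
Local Open Scope sesquilinear_scope.

(* The metric topology of the complex plane: [R[i]] is a [numFieldType], whose
   norm-induced topology is the one carried by [(R[i])^o]. *)
HB.instance Definition _ (R : realType) :=
  PseudoPointedMetric.copy R[i] (R[i])^o.

Section unitary_group.
Variables (R : realType) (d : nat).

Definition unitary_group : Type := {U : 'M[R[i]]_d | U \is unitarymx}.

HB.instance Definition _ := Choice.on unitary_group.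

Fact one_unitary : (1%:M : 'M[R[i]]_d) \is unitarymx.
Proof. by apply/unitarymxP; rewrite mul1mx trmx1 map_scalar_mx rmorph1. Qed.

(* The chosen point, the identity matrix, plays no role: [measurableType]
   structures on generated sigma-algebras are only provided on pointed types. *)
HB.instance Definition _ :=
  isPointed.Build unitary_group (exist _ 1%:M one_unitary).

Definition umul (V U : unitary_group) : unitary_group :=
  exist _ (val V *m val U) (mul_unitarymx (valP V) (valP U)).

Definition unitary_open : set (set unitary_group) :=
  [set (fun U : unitary_group => val U) @^-1` O | O in
    [set O : set 'M[R[i]]_d | open O]].

Definition unitary_borel := g_sigma_algebraType unitary_open.

(* Left invariance is enough: the compact group U(d) carries exactly one
   left-invariant Borel probability measure, and it is also right-invariant. *)
Definition is_haar (mu : probability unitary_borel R) : Prop :=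
  forall (V : unitary_group) (E : set unitary_borel), measurable E ->
    mu (umul V @` E) = mu E.

(* The library only integrates real-valued functions. *)
Definition cintegral (mu : probability unitary_borel R)
    (f : unitary_group -> R[i]) : R[i] :=
  (\int[mu]_U complex.Re (f U)) +i* (\int[mu]_U complex.Im (f U)).

(* [heis U O] is written with a tilde over O in the literature. *)
Definition heis (U : unitary_group) (O : 'M[R[i]]_d) : 'M[R[i]]_d :=
  (val U)^t* *m O *m val U.

Definition haar_otoc8 (mu : probability unitary_borel R)
    (A B C D : 'M[R[i]]_d) : R[i] :=
  cintegral mu (fun U => d%:R^-1 *
    \tr (A *m heis U B *m C *m heis U D *m
         A^t* *m (heis U D)^t* *m C^t* *m (heis U B)^t*)).

End unitary_group.

Section pauli.
Variable R : realType.

Definition mx2 (a b c d : R[i]) : 'M[R[i]]_2 :=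
  \matrix_(i < 2, j < 2)
    if i == 0 then (if j == 0 then a else b) else (if j == 0 then c else d).

Definition pauliX : 'M[R[i]]_2 := mx2 0 1 1 0.
Definition pauliY : 'M[R[i]]_2 := mx2 0 (0 -i* 1) (0 +i* 1) 0.
Definition pauliZ : 'M[R[i]]_2 := mx2 1 0 0 (- 1).

(* [tens_prod P] is [P 0 *t P 1 *t ... *t P n.-1]; the cast only identifies
   the dimension [2 * 2 ^ n] with [2 ^ n.+1]. *)
Fixpoint tens_prod (n : nat) : ('I_n -> 'M[R[i]]_2) -> 'M[R[i]]_(2 ^ n) :=
  match n with
  | 0 => fun=> 1%:M
  | n'.+1 => fun P => castmx (esym (expnS 2 n'), esym (expnS 2 n'))
      (tensmx (P ord0) (tens_prod (fun i => P (lift ord0 i))))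
  end.

Definition pauli_operator (n : nat) (M : 'M[R[i]]_(2 ^ n)) : Prop :=
  exists2 P : 'I_n -> 'M[R[i]]_2,
    forall j, P j \in [:: 1%:M; pauliX; pauliY; pauliZ] & M = tens_prod P.

End pauli.

(* Main.v *)
Require Import Defs.
From mathcomp Require Import all_boot all_order all_algebra fingroup perm.
From mathcomp Require Import complex mxtens ring lra.
From mathcomp Require Import all_classical all_reals all_analysis.
From mathcomp Require Import measurable_realfun.

Set Implicit Arguments.
Unset Strict Implicit.
Unset Printing Implicit Defensive.

Import Order.TTheory GRing.Theory Num.Theory.
Import numFieldNormedType.Exports.

Local Open Scope classical_set_scope.
Local Open Scope ring_scope.
Local Open Scope complex_scope.
Local Open Scope sesquilinear_scope.

(** Write [X_k = U A_k U^*]. Up to cyclicity, the correlator is the integral of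
    [tr (X_0 B X_1 D X_2 D X_3 B)] with [(A_0, .., A_3) = (A, C, A, C)].
    Left invariance says that the moment [M = \int X_0 (x) .. (x) X_3] commutes with
    [V (x) .. (x) V] for every unitary [V]; taking [V = 1 + w P] with [P] a projection
    and extracting the coefficient of [w], [M] commutes with the diagonal action of
    every matrix unit. Contracting one slot yields a Schwinger-Dyson equation: for
    [u p] the contraction of [M] with [(B, D, D, B)] along a permutation [p], the sum
    of [d * u p] and of the [u (t p)], [t] a transposition moving that slot, is
    expressed by moments in which two of the [A_k] are merged.
    Merging the slots one after the other, with [tr A = tr C = tr (A C) = 0] and
    [A ^ 2 = C ^ 2 = 1], ends at the traces of products of [B] and [D] along the cycles
    of [p]. These are at most [d] for odd [p] and at most [d ^ 2] for even [p], so
    parity makes all subleading terms small enough; the two leading contributions to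
    the 4-cycle cancel, which leaves [O(d ^ -3)] for the unnormalised trace. *)

(** * Integration over the unitary group *)

Lemma continuous_mulmx_coef (K : numFieldType) (m n p : nat)
    (V : 'M[K]_(m, n)) i j : continuous (fun M : 'M[K]_(n, p) => (V *m M) i j).
Proof.
move=> M; rewrite /continuous_at mxE; under eq_fun do rewrite mxE.
elim: (index_enum _) => [|k r IH].
  rewrite big_nil.
  have -> : (fun N : 'M[K]_(n, p) => \sum_(k <- [::]) V i k * N k j) = cst 0.
    by apply/funext => N; rewrite big_nil.
  exact: (@cvg_cst K _ _ (nbhs M)).
rewrite big_cons.
have -> : (fun N : 'M[K]_(n, p) => \sum_(l <- k :: r) V i l * N l j) =
    (fun N => V i k * N k j + \sum_(l <- r) V i l * N l j).
  by apply/funext => N; rewrite big_cons.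
apply: cvgD IH; apply: cvgMl_tmp; exact: coord_continuous.
Qed.

Section unitary_integration.
Variables (R : realType) (d : nat).
Local Notation C := R[i].
Local Notation G := (unitary_borel R d).

Lemma continuous_Re : continuous (fun z : C => complex.Re z).
Proof.
move=> z s /= /(nbhs_ballP (complex.Re z)) [e /= e0 es].
apply/nbhs_ballP; exists e%:C; first by rewrite /= ltcR.
move=> y; rewrite /ball /= => yz; apply: es; rewrite /ball /=.
rewrite -ltcR; apply: le_lt_trans yz.
by rewrite -raddfB /=; exact: normc_ge_Re.
Qed.

Lemma normc_ge_Im (z : C) : `|complex.Im z|%:C <= `|z|.
Proof.
rewrite -normrN -ReiNIm; apply: le_trans (normc_ge_Re _) _.
by rewrite normrM [`|'i%C|]normc_def /= expr0n add0r expr1n sqrtr1 mulr1.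
Qed.

Lemma continuous_Im : continuous (fun z : C => complex.Im z).
Proof.
move=> z s /= /(nbhs_ballP (complex.Im z)) [e /= e0 es].
apply/nbhs_ballP; exists e%:C; first by rewrite /= ltcR.
move=> y; rewrite /ball /= => yz; apply: es; rewrite /ball /=.
rewrite -ltcR; apply: le_lt_trans yz.
by rewrite -raddfB /=; exact: normc_ge_Im.
Qed.

Lemma continuous_mulmx (V : 'M[C]_d) : continuous (fun M : 'M[C]_d => V *m M).
Proof.
move=> M A /= [P MP PA]; rewrite nbhs_simpl /=.
have : nbhs M [set N : 'M[C]_d | forall i j, P i j ((V *m N) i j)].
  have FM : Filter (nbhs M) := nbhs_filter M.
  apply: (@filter_forall _ _ _ _ FM) => i; apply: (@filter_forall _ _ _ _ FM) => j.
  exact: (@continuous_mulmx_coef C) (MP i j).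
by apply: filterS => N; exact: PA.
Qed.

(** Left multiplication is continuous on all matrices, so it pulls a generating set, the trace of an
    open set of matrices, back to another generating set. *)
Lemma measurable_umul (V : unitary_group R d) :
  measurable_fun [set: G] (umul V : G -> G).
Proof.
have := @measurability _ _ G G setT (umul V) (@unitary_open R d) erefl.
apply.
move=> _ [_ [W Wopen <-] <-]; rewrite setTI.
apply: sub_sigma_algebra; exists ((fun M : 'M[C]_d => val V *m M) @^-1` W) => //.
by apply: open_comp => // M _; exact: continuous_mulmx.
Qed.

(** Boundedness is recorded rather than integrability because products preserve it; over a
    probability measure it yields integrability. *)
Definition bounded_measurable (f : G -> R) :=
  measurable_fun [set: G] f /\ exists K : R, forall U, `|f U| <= K.

Lemma bounded_measurable_cst (a : R) : bounded_measurable (cst a).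
Proof. by split=> //; exists `|a|. Qed.

Lemma bounded_measurableD (f g : G -> R) : bounded_measurable f ->
  bounded_measurable g -> bounded_measurable (fun U => f U + g U).
Proof.
move=> [mf [K fK]] [mg [L gL]]; split; first exact: measurable_funD.
by exists (K + L) => U; apply: le_trans (ler_normD _ _) (lerD _ _).
Qed.

Lemma bounded_measurableM (f g : G -> R) : bounded_measurable f ->
  bounded_measurable g -> bounded_measurable (fun U => f U * g U).
Proof.
move=> [mf [K fK]] [mg [L gL]]; split; first exact: measurable_funM.
by exists (K * L) => U; rewrite normrM ler_pM.
Qed.

Lemma bounded_measurableN (f : G -> R) : bounded_measurable f ->
  bounded_measurable (fun U => - f U).
Proof.
move=> [mf [K fK]]; split; first exact: measurableT_comp.
by exists K => U; rewrite normrN.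
Qed.

Lemma bounded_measurable_integrable (mu : probability G R) (f : G -> R) :
  bounded_measurable f -> mu.-integrable [set: G] (EFin \o f).
Proof.
move=> [mf [K fK]]; apply: measurable_bounded_integrable => //.
  exact: le_lt_trans (probability_le1 mu measurableT) (ltry _).
exists K; split; first exact: num_real.
by move=> x Kx U _ /=; apply: le_trans (fK U) (ltW Kx).
Qed.

Lemma haar_Rintegral (mu : probability G R) (V : unitary_group R d)
    (f : G -> R) : is_haar mu -> bounded_measurable f ->
  \int[mu]_U f (umul V U) = \int[mu]_U f U.
Proof.
move=> mu_haar bf; have mf := bf.1.
have bfV : bounded_measurable (f \o umul V).
  split; last by have [_ [K fK]] := bf; exists K => U; exact: fK.
  exact: measurableT_comp mf (measurable_umul V).
rewrite /Rintegral; congr fine.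
have mfE := (measurable_EFinP _ _).2 mf.
have := integral_pushforward (measurable_umul V) mfE
  (bounded_measurable_integrable mu bfV) measurableT.
rewrite preimage_setT => <-.
apply: eq_measure_integral; first exact: measurable_umul.
move=> mumul E mE _.
rewrite /= /pushforward.
(* [is_haar] speaks of images while a pushforward uses preimages: the preimage under [V] is the
   image under the adjoint of [V]. *)
pose W : unitary_group R d := exist _ ((val V)^t* ) (etrans (trmxC_unitary _) (valP V)).
have -> : umul V @^-1` E = umul W @` E.
  apply/seteqP; split=> U /=.
    exists (umul V U) => //; apply: val_inj => /=.
    by rewrite mulmxA; move/unitarymxP/mulmx1C: (valP V) => ->; rewrite mul1mx.
  move=> [U' EU' <-]; suff -> : umul V (umul W U') = U' by [].
  apply: val_inj => /=.
  by rewrite mulmxA; move/unitarymxP: (valP V) => ->; rewrite mul1mx.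
exact: mu_haar.
Qed.

End unitary_integration.

(** Each row of a unitary matrix has Euclidean norm one. *)
Lemma coef_unitary_le1 (K : numClosedFieldType) (m n : nat) (U : 'M[K]_(m, n)) :
  U \is unitarymx -> forall i j, `|U i j| <= 1.
Proof.
move=> /unitarymxP UU i j; have /matrixP /(_ i i) := UU; rewrite !mxE eqxx.
rewrite (bigD1 j) //= !mxE -normCK => UU1.
rewrite -(@ler_pXn2r _ 2) ?nnegrE // expr1n -[1]/(true%:R) -UU1 lerDl sumr_ge0 // => k _.
by rewrite !mxE -normCK exprn_ge0.
Qed.

(** * Integrals of bounded complex functions *)

Section complex_integration.
Variables (R : realType) (d : nat).
Local Notation C := R[i].
Local Notation G := (unitary_borel R d).

Definition complex_bounded_measurable (f : G -> C) :=
  bounded_measurable (fun U => complex.Re (f U)) /\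
  bounded_measurable (fun U => complex.Im (f U)).

Local Notation cbm := complex_bounded_measurable.

Lemma cbm_cst (a : C) : cbm (cst a).
Proof. by split; exact: bounded_measurable_cst. Qed.

Lemma cbmD (f g : G -> C) : cbm f -> cbm g -> cbm (fun U => f U + g U).
Proof.
move=> [fr fi] [gr gi]; split.
  by under eq_fun do rewrite raddfD; exact: bounded_measurableD.
by under eq_fun do rewrite raddfD; exact: bounded_measurableD.
Qed.

Lemma cbmM (f g : G -> C) : cbm f -> cbm g -> cbm (fun U => f U * g U).
Proof.
have ReM (x y : C) : complex.Re (x * y) =
    complex.Re x * complex.Re y + - (complex.Im x * complex.Im y).
  by case: x; case: y.
have ImM (x y : C) : complex.Im (x * y) =
    complex.Re x * complex.Im y + complex.Im x * complex.Re y.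
  by case: x; case: y.
move=> [fr fi] [gr gi]; split.
  under eq_fun do rewrite ReM; apply: bounded_measurableD.
    exact: bounded_measurableM.
  by apply: bounded_measurableN; exact: bounded_measurableM.
by under eq_fun do rewrite ImM; apply: bounded_measurableD;
  exact: bounded_measurableM.
Qed.

Lemma cbm_conj (f : G -> C) : cbm f -> cbm (fun U => (f U)^*).
Proof.
move=> [fr fi]; split.
  by have -> : (fun U => complex.Re (f U)^*) = (fun U => complex.Re (f U))
    by apply/funext => U; case: (f U).
have -> : (fun U => complex.Im (f U)^*) = (fun U => - complex.Im (f U))
  by apply/funext => U; case: (f U).
exact: bounded_measurableN.
Qed.

Lemma cbm_sum (I : Type) (r : seq I) (P : pred I) (f : I -> G -> C) :
  (forall i, P i -> cbm (f i)) -> cbm (fun U => \sum_(i <- r | P i) f i U).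
Proof.
move=> bf; elim: r => [|i r IH].
  rewrite (_ : (fun U => _) = cst 0); first exact: cbm_cst.
    by apply/funext => U; rewrite big_nil.
case Pi: (P i); under eq_fun do rewrite big_cons Pi; last by [].
apply: cbmD => //.
exact: bf.
Qed.

Lemma cbm_prod (I : Type) (r : seq I) (P : pred I) (f : I -> G -> C) :
  (forall i, P i -> cbm (f i)) -> cbm (fun U => \prod_(i <- r | P i) f i U).
Proof.
move=> bf; elim: r => [|i r IH].
  rewrite (_ : (fun U => _) = cst 1); first exact: cbm_cst.
    by apply/funext => U; rewrite big_nil.
case Pi: (P i); under eq_fun do rewrite big_cons Pi; last by [].
apply: cbmM => //.
exact: bf.
Qed.

Lemma cbm_coef (i j : 'I_d) : cbm (fun U : G => val U i j).
Proof.
have coef_le1 (U : G) : `|val U i j| <= 1 :> C := coef_unitary_le1 (valP U) i j.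
have meas (h : C -> R) : continuous h ->
    measurable_fun [set: G] (fun U : G => h (val U i j)).
  (* Open half-lines generate the Borel sets of the line, and their preimages here are traces of
     open sets of matrices. *)
  move=> ch; apply: (measurability _ (RGenOInfty.measurableE R)).
  move=> _ [_ [x ->] <-]; rewrite setTI.
  apply: sub_sigma_algebra.
  exists ((fun M : 'M[C]_d => h (M i j)) @^-1` `]x, +oo[%classic) => //.
  apply: open_comp => [M _|]; last exact: interval_open.
  apply: (@continuous_comp _ _ _ (fun M : 'M[C]_d => M i j) h); last exact: ch.
  exact: (@coord_continuous C).
split; split.
- by apply: meas; exact: continuous_Re.
- exists 1 => U; rewrite -lecR; apply: le_trans (coef_le1 U).
  exact: normc_ge_Re.
- by apply: meas; exact: continuous_Im.
- exists 1 => U; rewrite -lecR; apply: le_trans (coef_le1 U).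
  exact: normc_ge_Im.
Qed.

Variable mu : probability G R.

Lemma cintegral_cst (a : C) : cintegral mu (cst a) = a.
Proof.
rewrite /cintegral /= !Rintegral_cst //=.
by rewrite [mu setT](@probability_setT _ _ _ mu) !mulr1; case: a.
Qed.

Lemma cintegralD (f g : G -> C) : cbm f -> cbm g ->
  cintegral mu (fun U => f U + g U) = cintegral mu f + cintegral mu g.
Proof.
move=> [fr fi] [gr gi]; rewrite /cintegral /GRing.add /=; congr Complex.
  rewrite -RintegralD //; try exact: bounded_measurable_integrable.
  by apply: eq_Rintegral => U _; case: (f U); case: (g U).
rewrite -RintegralD //; try exact: bounded_measurable_integrable.
by apply: eq_Rintegral => U _; case: (f U); case: (g U).
Qed.

Lemma cintegralZ (a : C) (f : G -> C) : cbm f ->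
  cintegral mu (fun U => a * f U) = a * cintegral mu f.
Proof.
case: a => a b [fr fi]; rewrite /cintegral [RHS]/GRing.mul /=.
have ar (c : R) h : bounded_measurable h ->
    mu.-integrable setT (EFin \o (fun U : G => c * h U)).
  move=> bh; apply: bounded_measurable_integrable.
  by apply: bounded_measurableM => //; exact: bounded_measurable_cst.
congr Complex.
  rewrite -!RintegralZl //; try exact: bounded_measurable_integrable.
  rewrite -RintegralB //; try exact: ar.
  by apply: eq_Rintegral => U _; case: (f U).
rewrite -!RintegralZl //; try exact: bounded_measurable_integrable.
rewrite -RintegralD //; try exact: ar.
by apply: eq_Rintegral => U _; case: (f U).
Qed.

Lemma cintegral_sum (I : Type) (r : seq I) (P : pred I) (f : I -> G -> C) :
  (forall i, P i -> cbm (f i)) ->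
  cintegral mu (fun U => \sum_(i <- r | P i) f i U) =
  \sum_(i <- r | P i) cintegral mu (f i).
Proof.
move=> bf; elim: r => [|i r IH].
  rewrite big_nil (_ : (fun U => _) = cst 0); first exact: cintegral_cst.
  by apply/funext => U; rewrite big_nil.
rewrite big_cons; case Pi: (P i); under eq_fun do rewrite big_cons Pi; last by [].
rewrite cintegralD ?IH //; first exact: bf.
exact: cbm_sum.
Qed.

Lemma haar_cintegral (V : unitary_group R d) (f : G -> C) :
  is_haar mu -> cbm f -> cintegral mu (fun U => f (umul V U)) = cintegral mu f.
Proof.
move=> mu_haar [fr fi]; rewrite /cintegral.
by rewrite (haar_Rintegral V mu_haar fr) (haar_Rintegral V mu_haar fi).
Qed.

End complex_integration.

(** * Schwinger-Dyson equations *)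

(** Expansion over the set [S] of factors that contribute [w * E k]. It serves to compare the
    coefficients of [w] in two such products. *)
Lemma prod_affine_expansion (K : comNzRingType) (n : nat) (D E : 'I_n -> K) (w : K) :
  \prod_k (D k + w * E k) =
  \sum_(m < n.+1) w ^+ m *
    (\sum_(S : {set 'I_n} | #|S| == m) \prod_k (if k \in S then E k else D k)).
Proof.
under eq_bigr do rewrite addrC.
rewrite bigA_distr.
(* Subsets of ['I_n] have at most [n] elements, so [inord] loses nothing. *)
rewrite (partition_big (fun S : {set 'I_n} => inord #|S| : 'I_n.+1) xpredT) //=.
apply: eq_bigr => m _; rewrite big_distrr /=.
have cardS (S : {set 'I_n}) : (inord #|S| == m) = (#|S| == m).
  by rewrite -val_eqE /= inordK // ltnS -[X in (_ <= X)%N](card_ord n) max_card.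
apply: eq_big => [S|S]; first exact: cardS.
rewrite cardS => /eqP <-.
rewrite -prodr_const [X in X * _]big_mkcond -big_split /=.
by apply: eq_bigr => k _; case: ifP; rewrite ?mul1r.
Qed.

Lemma sum_card1 (K : nmodType) (n : nat) (F : {set 'I_n} -> K) :
  \sum_(S : {set 'I_n} | #|S| == 1%N) F S = \sum_k F [set k]%SET.
Proof.
rewrite -(big_imset (h := @finset.set1 _) (A := predT)) /=; last first.
  by move=> x y _ _; exact: finset.set1_inj.
apply: eq_bigl => S; apply/cards1P/imsetP => [[k ->]|[k _ ->]]; by exists k.
Qed.

(** * Moments of conjugates and their commutation with matrix units *)

Section moments.
Variables (R : realType) (d : nat).
Local Notation C := R[i].
Local Notation G := (unitary_borel R d).
Local Notation cbm := (@complex_bounded_measurable R d).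

(** The opposite order to [heis]: a left translation of [U] by [V] then conjugates [uconj U A] by
    [V], which is how left invariance gets used. *)
Definition uconj (U : unitary_group R d) (A : 'M[C]_d) : 'M[C]_d :=
  val U *m A *m (val U)^t*.

Lemma uconj1 U : uconj U 1%:M = 1%:M.
Proof. by rewrite /uconj mulmx1; apply/unitarymxP; exact: valP. Qed.

Lemma uconjM U A B : uconj U A *m uconj U B = uconj U (A *m B).
Proof.
rewrite /uconj !mulmxA; congr (_ *m _); rewrite -!mulmxA; congr (_ *m (_ *m _)).
by rewrite mulmxA; move/unitarymxP/mulmx1C: (valP U) => ->; rewrite mul1mx.
Qed.

Lemma uconj_tr U A : \tr (uconj U A) = \tr A.
Proof.
rewrite /uconj mxtrace_mulC mulmxA.
by move/unitarymxP/mulmx1C: (valP U) => ->; rewrite mul1mx.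
Qed.

Lemma uconj_umul V U A : uconj (umul V U) A = val V *m uconj U A *m (val V)^t*.
Proof. by rewrite /uconj /= trmx_mul map_mxM !mulmxA. Qed.

Lemma cbm_mulmx (F H : G -> 'M[C]_d) :
  (forall i j, cbm (fun U => F U i j)) -> (forall i j, cbm (fun U => H U i j)) ->
  forall i j, cbm (fun U => (F U *m H U) i j).
Proof.
move=> bF bH i j; under eq_fun do rewrite mxE.
by apply: cbm_sum => k _; exact: cbmM.
Qed.

Lemma cbm_uconj A i j : cbm (fun U => uconj U A i j).
Proof.
move: i j; apply: cbm_mulmx; first apply: cbm_mulmx.
- by move=> i j; exact: cbm_coef.
- by move=> i j; exact: cbm_cst.
- move=> i j; under eq_fun do rewrite !mxE.
  by apply: cbm_conj; exact: cbm_coef.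
Qed.

Section invariance.
Variables (mu : probability G R) (n : nat) (A : 'I_n -> 'M[C]_d).
Hypothesis mu_haar : is_haar mu.
Local Notation X U k := (uconj U (A k)).
Implicit Types f g : 'I_n -> 'I_d.

(** The entry with row multi-index [f] and column multi-index [g] of the integral of the tensor
    product of the [uconj U (B k)]. *)
Definition moment (B : 'I_n -> 'M[C]_d) f g : C :=
  cintegral mu (fun U => \prod_k uconj U (B k) (f k) (g k)).

Lemma cbm_prod_uconj (B : 'I_n -> 'M[C]_d) f g :
  cbm (fun U => \prod_k uconj U (B k) (f k) (g k)).
Proof. by apply: cbm_prod => k _; exact: cbm_uconj. Qed.

(** Substituting [V U] for [U] on the right turns each [X] into its conjugate by [V], and the
    trailing [V] cancels the adjoint. *)
Lemma moment_commute_unitary (V : unitary_group R d) f g :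
  cintegral mu (fun U => \prod_k (val V *m X U k) (f k) (g k)) =
  cintegral mu (fun U => \prod_k (X U k *m val V) (f k) (g k)).
Proof.
rewrite -[RHS](haar_cintegral V mu_haar); last first.
  apply: cbm_prod => k _; apply: cbm_mulmx => i j; first exact: cbm_uconj.
  exact: cbm_cst.
congr cintegral; apply/funext => U; apply: eq_bigr => k _.
by rewrite uconj_umul mulmxKtV ?(valP V).
Qed.

(** Together with [right_action]: the moment tensor multiplied, on the left or on the right, by the
    sum over [k] of [P] acting on the [k]-th tensor factor. This sum is the linear part in [w] of
    the tensor power of [1 + w P]. *)
Let left_action (P : 'M[C]_d) f g : C :=
  \sum_k \sum_m P (f k) m * moment A [eta f with k |-> m] g.
Let right_action (P : 'M[C]_d) f g : C :=
  \sum_k \sum_m moment A f [eta g with k |-> m] * P m (g k).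

Lemma left_actionE P f g : left_action P f g =
  \sum_k cintegral mu (fun U =>
    \prod_l (if l \in [set k]%SET then (P *m X U l) (f l) (g l) else X U l (f l) (g l))).
Proof.
apply: eq_bigr => k _.
transitivity (\sum_m cintegral mu (fun U => P (f k) m *
    \prod_l X U l ([eta f with k |-> m] l) (g l))).
  by apply: eq_bigr => m _; rewrite cintegralZ //; exact: cbm_prod_uconj.
rewrite -cintegral_sum; last first.
  by move=> m _; apply: cbmM; [exact: cbm_cst|exact: cbm_prod_uconj].
congr cintegral; apply/funext => U.
rewrite [RHS](bigD1 k) //= inE eqxx mxE mulr_suml; apply: eq_bigr => m _.
rewrite (bigD1 k) //= eqxx mulrA; congr (_ * _).
by apply: eq_bigr => l /negPf lk; rewrite inE /= lk.
Qed.

Lemma right_actionE P f g : right_action P f g =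
  \sum_k cintegral mu (fun U =>
    \prod_l (if l \in [set k]%SET then (X U l *m P) (f l) (g l) else X U l (f l) (g l))).
Proof.
apply: eq_bigr => k _.
transitivity (\sum_m cintegral mu (fun U => P m (g k) *
    \prod_l X U l (f l) ([eta g with k |-> m] l))).
  apply: eq_bigr => m _; rewrite mulrC cintegralZ //; exact: cbm_prod_uconj.
rewrite -cintegral_sum; last first.
  by move=> m _; apply: cbmM; [exact: cbm_cst|exact: cbm_prod_uconj].
congr cintegral; apply/funext => U.
rewrite [RHS](bigD1 k) //= inE eqxx mxE mulr_suml; apply: eq_bigr => m _.
rewrite (bigD1 k) //= eqxx mulrA [P _ _ * _]mulrC; congr (_ * _).
by apply: eq_bigr => l /negPf lk; rewrite inE /= lk.
Qed.

(* The points [w] with [1 + w] on the unit circle, parametrised by [s]. *)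
Let z (s : nat) : C := -1 + s%:R * 'i%R.
Let w (s : nat) : C := 2%:R / z s.

Let z_conj s : (z s)^*%R = -1 - s%:R * 'i%R.
Proof. by rewrite /z rmorphD rmorphN1 rmorphM rmorph_nat /= conjCi mulrN. Qed.

Let z_neq0 s : z s != 0.
Proof.
have zz : z s * (-1 - s%:R * 'i%R) = (s ^ 2).+1%:R.
  rewrite /z -addn1 natrD natrX; have := @sqrCi C; set i := 'i%R => ii.
  have -> : (-1 + s%:R * i) * (-1 - s%:R * i) = 1 - s%:R ^+ 2 * i ^+ 2 by ring.
  by rewrite ii; ring.
apply/eqP => z0; move: zz; rewrite z0 mul0r => /esym/eqP.
by rewrite pnatr_eq0.
Qed.

Let w_inj : injective w.
Proof.
move=> s t /(mulfI _); rewrite pnatr_eq0 => /(_ isT) /invr_inj /addrI.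
by move=> /(mulIf (neq0Ci _)) /eqP; rewrite eqr_nat => /eqP.
Qed.

(** As [1 / w = z / 2], dividing by [w] times its conjugate reduces the claim to [Re z = -1]. *)
Let w_circle s : w s + (w s)^*%R + w s * (w s)^*%R = 0.
Proof.
have wc : (w s)^*%R = 2%:R / (z s)^*%R by rewrite /w rmorphM fmorphV rmorph_nat.
have zc0 : (z s)^*%R != 0 by rewrite conjC_eq0 z_neq0.
have zc : (z s)^*%R = - 2%:R - z s by rewrite z_conj /z; ring.
move: zc0; rewrite wc zc /w => zc0; field.
by rewrite z_neq0 zc0.
Qed.

(** For a projection [P] and [1 + w] of modulus one, [1 + w P] is unitary. Commutation of the moment
    with its tensor power is then a polynomial identity in [w] of degree at most [n], valid at
    [n + 1] distinct points, hence coefficient by coefficient; degree one is the claim. *)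
Lemma action_projection (P : 'M[C]_d) f g : P^t* = P -> P *m P = P ->
  left_action P f g = right_action P f g.
Proof.
move=> Padj Pidem; rewrite left_actionE right_actionE.
pose I (m : nat) := \sum_(S : {set 'I_n} | #|S| == m) cintegral mu (fun U =>
  \prod_l (if l \in S then (P *m X U l) (f l) (g l) else X U l (f l) (g l))).
pose J (m : nat) := \sum_(S : {set 'I_n} | #|S| == m) cintegral mu (fun U =>
  \prod_l (if l \in S then (X U l *m P) (f l) (g l) else X U l (f l) (g l))).
have cbmI (S : {set 'I_n}) : cbm (fun U => \prod_l
    (if l \in S then (P *m X U l) (f l) (g l) else X U l (f l) (g l))).
  apply: cbm_prod => l _; case: (l \in S); last exact: cbm_uconj.
  by apply: cbm_mulmx => i j; [exact: cbm_cst|exact: cbm_uconj].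
have cbmJ (S : {set 'I_n}) : cbm (fun U => \prod_l
    (if l \in S then (X U l *m P) (f l) (g l) else X U l (f l) (g l))).
  apply: cbm_prod => l _; case: (l \in S); last exact: cbm_uconj.
  by apply: cbm_mulmx => i j; [exact: cbm_uconj|exact: cbm_cst].
suff IJ : \poly_(m < n.+1) (I m - J m) = 0.
  transitivity (I 1%N); first by rewrite /I sum_card1.
  transitivity (J 1%N); last by rewrite /J sum_card1.
  apply/eqP; rewrite -subr_eq0.
  have := congr1 (fun p : {poly C} => p`_1) IJ; rewrite coef_poly coef0.
  case: ltnP => [_ ->//|]; rewrite ltnS leqn0 => /eqP n0 _.
  (* Here [n = 0]: the polynomial has no coefficient of degree one, and no subset has exactly one
     element. *)
  rewrite /I /J !big_pred0 ?subrr // => S;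
    by apply/negbTE; rewrite neq_ltn ltnS; apply/orP; left;
       apply: leq_trans (max_card _) _; rewrite card_ord n0.
apply: (@roots_geq_poly_eq0 _ _ [seq w s | s <- iota 0 n.+1]).
- apply/allP => _ /mapP[s _ ->].
  have Vunitary : 1%:M + w s *: P \is unitarymx.
    apply/unitarymxP; rewrite linearD /= map_mxD linearZ /= map_mxZ trmx1 map_mx1.
    rewrite Padj mulmxDl mul1mx mulmxDr mulmx1 -scalemxAl -scalemxAr Pidem.
    rewrite scalerA -addrA -!scalerDl.
    by rewrite [Y in Y *: P]addrCA [Y in Y *: P]addrA w_circle scale0r addr0.
  have := moment_commute_unitary (exist (fun V => V \is unitarymx) _ Vunitary) f g => /= VE.
  rewrite /root horner_poly.
  have -> : \sum_(i < n.+1) (I i - J i) * w s ^+ i =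
      \sum_(i < n.+1) w s ^+ i * I i - \sum_(i < n.+1) w s ^+ i * J i.
    by rewrite -sumrB; apply: eq_bigr => i _; rewrite mulrC mulrBr.
  rewrite subr_eq0; apply/eqP.
  transitivity (cintegral mu (fun U =>
      \prod_k ((1%:M + w s *: P) *m X U k) (f k) (g k))).
    rewrite (_ : (fun U => _) = (fun U => \sum_(m < n.+1) w s ^+ m *
      (\sum_(S : {set 'I_n} | #|S| == m) \prod_k (if k \in S
         then (P *m X U k) (f k) (g k) else X U k (f k) (g k))))); last first.
      apply/funext => U; rewrite -prod_affine_expansion; apply: eq_bigr => k _.
      by rewrite mulmxDl mul1mx -scalemxAl !mxE.
    rewrite cintegral_sum => [|i _]; last first.
      by apply: cbmM; [exact: cbm_cst|apply: cbm_sum].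
    apply: eq_bigr => i _; rewrite cintegralZ; last exact: cbm_sum.
    by rewrite cintegral_sum.
  rewrite VE.
  rewrite (_ : (fun U => _) = (fun U => \sum_(m < n.+1) w s ^+ m *
      (\sum_(S : {set 'I_n} | #|S| == m) \prod_k (if k \in S
         then (X U k *m P) (f k) (g k) else X U k (f k) (g k))))); last first.
    apply/funext => U; rewrite -prod_affine_expansion; apply: eq_bigr => k _.
    by rewrite mulmxDr mulmx1 -scalemxAr !mxE.
  rewrite cintegral_sum => [|i _]; last first.
    by apply: cbmM; [exact: cbm_cst|apply: cbm_sum].
  apply: eq_bigr => i _; rewrite cintegralZ; last exact: cbm_sum.
  by rewrite cintegral_sum.
- by rewrite map_inj_uniq ?iota_uniq.
- by rewrite size_map size_iota size_poly.
Qed.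

Let defect (P : 'M[C]_d) f g := left_action P f g - right_action P f g.

Let defectD P Q f g : defect (P + Q) f g = defect P f g + defect Q f g.
Proof.
rewrite /defect /left_action /right_action addrACA -opprD -!big_split /=.
by congr (_ - _); apply: eq_bigr => k _; rewrite -big_split /=; apply: eq_bigr => m _;
  rewrite mxE ?mulrDl ?mulrDr.
Qed.

Let defectZ a P f g : defect (a *: P) f g = a * defect P f g.
Proof.
rewrite /defect /left_action /right_action mulrBr !mulr_sumr.
by congr (_ - _); apply: eq_bigr => k _; rewrite mulr_sumr; apply: eq_bigr => m _;
  rewrite mxE; ring.
Qed.

(** Dividing by the squared norm [a] of [u] gives a projection, and [defect] is linear. *)
Let defect_rank1 (u : 'cV[C]_d) (a : nat) f g : (0 < a)%N ->
  u^t* *m u = a%:R%:M -> defect (u *m u^t*) f g = 0.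
Proof.
move=> a0 uu; have an0 : a%:R != 0 :> C by rewrite pnatr_eq0 -lt0n.
apply: (mulfI (invr_neq0 an0)); rewrite -defectZ mulr0.
apply/eqP; rewrite subr_eq0; apply/eqP; apply: action_projection.
  rewrite linearZ /= map_mxZ trmx_mul map_mxM trmxCK.
  by rewrite fmorphV rmorph_nat.
rewrite -scalemxAl -scalemxAr mulmxA -[u *m _ *m u]mulmxA uu.
by rewrite mul_mx_scalar -scalemxAl [in LHS]scalerA mulVf // scale1r.
Qed.

(** Polarisation: with [u = e_i + c e_j] and [c] of modulus one, the diagonal units drop out of the
    rank-one case and a relation between [E_ij] and [E_ji] remains. *)
Lemma action_delta i j f g :
  left_action (delta_mx i j) f g = right_action (delta_mx i j) f g.
Proof.
have diag k : defect (delta_mx k k) f g = 0.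
  have := @defect_rank1 (delta_mx k 0) 1 f g isT.
  rewrite trmx_delta map_delta_mx !mul_delta_mx; apply.
  by apply/matrixP => a b; rewrite !mxE !ord1 !eqxx.
apply/eqP; rewrite -subr_eq0 -/(defect _ f g); apply/eqP.
have [<-|ij] := eqVneq i j; first exact: diag.
have off (c : C) : c * c^*%R = 1 ->
    c^*%R * defect (delta_mx i j) f g + c * defect (delta_mx j i) f g = 0.
  move=> cc.
  pose u : 'cV[C]_d := delta_mx i 0 + c *: delta_mx j 0.
  have uadj : u^t* = delta_mx 0 i + c^*%R *: delta_mx 0 j.
    by rewrite [u^T]linearD /= [(c *: _)^T]linearZ /= map_mxD map_mxZ
      !trmx_delta !map_delta_mx.
  have ji : j != i by rewrite eq_sym.
  have uu : u^t* *m u = 2%:R%:M.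
    rewrite uadj !(mulmxDl, mulmxDr) -!scalemxAl -!scalemxAr !mul_delta_mx.
    rewrite !(mul_delta_mx_0 _ _ _ ij, mul_delta_mx_0 _ _ _ ji) !scaler0 add0r addr0.
    rewrite scalerA mulrC cc scale1r; apply/matrixP => a b.
    by rewrite !mxE !ord1 !eqxx.
  have := @defect_rank1 u 2 f g isT uu.
  rewrite uadj !(mulmxDl, mulmxDr) -!scalemxAl -!scalemxAr !mul_delta_mx.
  by rewrite scalerA cc !defectD !defectZ !diag mulr0 addr0 add0r.
(* The choice [c = 1] makes the two defects opposite, and [c = i] makes them equal. *)
have := off 1; rewrite rmorph1 !mul1r => /(_ erefl) /eqP.
rewrite addr_eq0 => /eqP dij.
have := off 'i%R; rewrite conjCi mulrN -expr2 sqrCi opprK => /(_ erefl).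
rewrite mulNr dij mulrN opprK -mulr2n => /eqP; rewrite mulrn_eq0 /=.
by rewrite mulf_eq0 (negPf (neq0Ci _)) /= => /eqP ->; rewrite oppr0.
Qed.

End invariance.
End moments.

Section schwinger_dyson.
Variables (R : realType) (d : nat).
Local Notation C := R[i].
Local Notation G := (unitary_borel R d).
Variables (mu : probability G R) (n : nat).
Hypothesis mu_haar : is_haar mu.
Local Notation M := (@moment R d mu n).
Implicit Types (A : 'I_n -> 'M[C]_d) (f g : 'I_n -> 'I_d).

(** The sum over [i] is the trace of the conjugate in slot [j]; the Kronecker delta is the entry of
    the identity left there. *)
Lemma contract_same_slot A (j : 'I_n) f g :
  (f j == g j)%:R * \sum_i M A [eta f with j |-> i] [eta g with j |-> i] =
  \tr (A j) * M [eta A with j |-> 1%:M] f g.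
Proof.
rewrite /moment -cintegral_sum; last by move=> i _; exact: cbm_prod_uconj.
rewrite -!cintegralZ; first last.
- by apply: cbm_sum => i _; exact: cbm_prod_uconj.
- exact: cbm_prod_uconj.
congr cintegral; apply/funext => U.
rewrite [in RHS](bigD1 j) //= eqxx uconj1 mxE mulrCA; congr (_ * _).
rewrite -(uconj_tr U) /mxtrace mulr_suml; apply: eq_bigr => i _.
rewrite (bigD1 j) //= eqxx; congr (_ * _).
by apply: eq_bigr => l /negPf lj; rewrite /= lj.
Qed.

(** The shared index [i] multiplies the conjugates of [A k] and [A j] into the entry [(f k, g j)];
    the delta is the entry [(f j, g k)] of the identity left in slot [k]. The transposition records
    this exchange of row indices. *)
Lemma contract_distinct_slots A (j k : 'I_n) f g : k != j ->
  (f j == g k)%:R * \sum_i M A [eta f with j |-> i] [eta g with k |-> i] =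
  M [eta A with j |-> A k *m A j, k |-> 1%:M] (f \o tperm j k) g.
Proof.
move=> kj; have jk : j != k by rewrite eq_sym.
rewrite /moment -cintegral_sum; last by move=> i _; exact: cbm_prod_uconj.
rewrite -!cintegralZ; last by apply: cbm_sum => i _; exact: cbm_prod_uconj.
congr cintegral; apply/funext => U.
rewrite [in RHS](bigD1 j) //= [in RHS](bigD1 k) //= !eqxx !(negPf kj) ?(negPf jk).
rewrite tpermL tpermR uconj1 -uconjM [1%:M _ _]mxE [in RHS]mulrCA; congr (_ * _).
rewrite [in RHS]mxE mulr_suml; apply: eq_bigr => i _.
rewrite (bigD1 j) //= (bigD1 k) //= !eqxx (negPf kj) (negPf jk) mulrCA mulrA.
congr (_ * _); apply: eq_bigr => l /andP[lj lk].
by rewrite /= (negPf lj) (negPf lk) tpermD // eq_sym.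
Qed.

Lemma moment_swap A (j k : 'I_n) f g : k != j ->
  M A [eta [eta f with j |-> f k] with k |-> f j] g = M A (f \o tperm j k) g.
Proof.
move=> kj; congr (M A _ g); apply/funext => l /=.
have [->|lk] := eqVneq l k; first by rewrite tpermR.
have [->|lj] := eqVneq l j; first by rewrite tpermL.
by rewrite tpermD // eq_sym.
Qed.

Lemma moment_schwinger_dyson A (j : 'I_n) f g :
  d%:R * M A f g + \sum_(k | k != j) M A (f \o tperm j k) g =
  \tr (A j) * M [eta A with j |-> 1%:M] f g +
  \sum_(k | k != j)
    M [eta A with j |-> A k *m A j, k |-> 1%:M] (f \o tperm j k) g.
Proof.
(* Commutation with the unit [E_(i, f j)] is taken at the rows [f] with entry [j] replaced by [i],
   then summed over [i]. Slot [j] contributes the same moment [d] times; every other slot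
   contributes a transposition. *)
transitivity (\sum_(i < d) \sum_k \sum_m (delta_mx i (f j) : 'M[C]_d)
    ([eta f with j |-> i] k) m * M A [eta [eta f with j |-> i] with k |-> m] g).
  rewrite exchange_big [RHS](bigD1 j) //=; congr (_ + _).
    rewrite eqxx -[X in X%:R](card_ord d) mulr_natl -sumr_const.
    apply: eq_bigr => i _.
    rewrite [RHS](bigD1 (f j)) //= [X in _ + X]big1 ?addr0; last first.
      by move=> m /negPf mj; rewrite mxE eqxx mj mul0r.
    rewrite mxE !eqxx mul1r; congr (M A _ g).
    by apply/funext => l /=; case: eqVneq => [->|].
  apply: eq_bigr => k kj; rewrite (negPf kj).
  rewrite [RHS](bigD1 (f k)) //= [X in _ + X]big1 ?addr0; last first.
    by move=> i ik; rewrite big1 // => m _; rewrite mxE eq_sym (negPf ik) mul0r.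
  rewrite [RHS](bigD1 (f j)) //= [X in _ + X]big1 ?addr0; last first.
    by move=> m mj; rewrite mxE (negPf mj) andbF mul0r.
  by rewrite mxE !eqxx mul1r moment_swap.
transitivity (\sum_(i < d) \sum_k \sum_m M A [eta f with j |-> i] [eta g with k |-> m] *
      (delta_mx i (f j) : 'M[C]_d) m (g k)).
  by apply: eq_bigr => i _; exact: action_delta.
rewrite exchange_big [LHS](bigD1 j) //=; congr (_ + _).
  rewrite -contract_same_slot mulr_sumr; apply: eq_bigr => i _.
  rewrite (bigD1 i) //= [X in _ + X]big1 ?addr0; last first.
    by move=> m /negPf mi; rewrite mxE mi mulr0.
  by rewrite mxE eqxx /= mulrC eq_sym.
apply: eq_bigr => k kj; rewrite -contract_distinct_slots // mulr_sumr.
apply: eq_bigr => i _; rewrite (bigD1 i) //= [X in _ + X]big1 ?addr0; last first.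
  by move=> m /negPf mi; rewrite mxE mi mulr0.
by rewrite mxE eqxx /= mulrC eq_sym.
Qed.

End schwinger_dyson.

(** * Traces and correlators twisted by a permutation *)

Section twisted_trace.
Variables (K : comNzRingType) (d n : nat).
Implicit Types (Y : 'I_n -> 'M[K]_d) (p s : 'S_n).

(* The product over the cycles of [p] of the traces of the matrices along the
   cycle; each cycle is followed backwards. *)
Definition twisted_trace Y p : K :=
  \sum_(f : {ffun 'I_n -> 'I_d}) \prod_k Y k (f (p k)) (f k).

(** Relabelling the slots by [s]; it leaves one representative per conjugacy class to compute. *)
Lemma twisted_trace_conj Y p s :
  twisted_trace Y (p ^ s)%g = twisted_trace (Y \o s) p.
Proof.
rewrite /twisted_trace.
rewrite (reindex (fun f : {ffun 'I_n -> 'I_d} => [ffun k => f (s^-1%g k)])) /=; last first.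
  exists (fun f : {ffun 'I_n -> 'I_d} => [ffun k => f (s k)]) => f _;
  by apply/ffunP => k; rewrite !ffunE ?permK ?permKV.
apply: eq_bigr => f _; rewrite (reindex_inj (@perm_inj _ s)) /=.
apply: eq_bigr => k _; rewrite !ffunE permK.
by rewrite /conjg !permM permK permK.
Qed.

End twisted_trace.

Section correlator.
Variables (R : realType) (d : nat).
Local Notation C := R[i].
Local Notation G := (unitary_borel R d).
Variables (mu : probability G R) (n : nat).
Hypothesis mu_haar : is_haar mu.
Variable B : 'I_n -> 'M[C]_d.
Implicit Types (A : 'I_n -> 'M[C]_d) (p : 'S_n).

Definition correlator A p : C :=
  \sum_(f : {ffun 'I_n -> 'I_d}) \sum_(g : {ffun 'I_n -> 'I_d})
    moment mu A (f \o p) g * \prod_k B k (g k) (f k).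

(** Summing over [g] multiplies [uconj U (A k)] by [B k] slot by slot. *)
Lemma correlatorE A p : correlator A p =
  cintegral mu (fun U => twisted_trace (fun k => uconj U (A k) *m B k) p).
Proof.
have bm f g : complex_bounded_measurable (fun U : G =>
    (\prod_k B k (g k) (f k)) * \prod_k uconj U (A k) (f (p k)) (g k)).
  by apply: cbmM; [exact: cbm_cst|exact: (cbm_prod_uconj A (f \o p) g)].
transitivity (cintegral mu (fun U => \sum_(f : {ffun 'I_n -> 'I_d})
    \sum_(g : {ffun 'I_n -> 'I_d})
    (\prod_k B k (g k) (f k)) * \prod_k uconj U (A k) (f (p k)) (g k))).
  rewrite cintegral_sum => [|f _]; last by apply: cbm_sum => g _; exact: bm.
  apply: eq_bigr => f _; rewrite cintegral_sum => [|g _]; last exact: bm.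
  apply: eq_bigr => g _; rewrite cintegralZ; last exact: (cbm_prod_uconj A (f \o p) g).
  by rewrite mulrC.
congr cintegral; apply/funext => U; apply: eq_bigr => f _.
transitivity (\sum_(g : {ffun 'I_n -> 'I_d})
    \prod_k (B k (g k) (f k) * uconj U (A k) (f (p k)) (g k))).
  by apply: eq_bigr => g _; rewrite big_split.
rewrite -(bigA_distr_bigA (fun k i => B k i (f k) * uconj U (A k) (f (p k)) i)) /=.
by apply: eq_bigr => k _; rewrite mxE; apply: eq_bigr => i _; rewrite mulrC.
Qed.

(** The end of the reduction: the integrand no longer depends on [U]. *)
Lemma correlator1 p : correlator (fun=> 1%:M) p = twisted_trace B p.
Proof.
rewrite correlatorE -[RHS](cintegral_cst mu); congr cintegral; apply/funext => U.
by congr twisted_trace; apply/funext => k; rewrite uconj1 mul1mx.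
Qed.

Lemma correlator_schwinger_dyson A (j : 'I_n) p :
  d%:R * correlator A p + \sum_(k | k != j) correlator A (tperm j k * p)%g =
  \tr (A j) * correlator [eta A with j |-> 1%:M] p +
  \sum_(k | k != j)
    correlator [eta A with j |-> A k *m A j, k |-> 1%:M] (tperm j k * p)%g.
Proof.
have gather (a : C) (H : _ -> _ -> C) (J : 'I_n -> _ -> _ -> C) :
    a * (\sum_(f : {ffun 'I_n -> 'I_d}) \sum_(g : {ffun 'I_n -> 'I_d})
           H f g * \prod_k B k (g k) (f k)) +
    \sum_(k | k != j) \sum_(f : {ffun 'I_n -> 'I_d}) \sum_(g : {ffun 'I_n -> 'I_d})
           J k f g * \prod_k B k (g k) (f k) =
    \sum_(f : {ffun 'I_n -> 'I_d}) \sum_(g : {ffun 'I_n -> 'I_d})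
       (a * H f g + \sum_(k | k != j) J k f g) * \prod_k B k (g k) (f k).
  rewrite mulr_sumr exchange_big -big_split /=; apply: eq_bigr => f _.
  rewrite mulr_sumr exchange_big -big_split /=; apply: eq_bigr => g _.
  by rewrite mulrDl mulrA mulr_suml.
(* Products of permutations act from left to right, so transposing row indices multiplies [p] on the
   left. *)
have comp (f : {ffun 'I_n -> 'I_d}) k :
    f \o (tperm j k * p)%g = (f \o p) \o tperm j k.
  by apply/funext => l /=; rewrite permM.
etransitivity; first exact: (gather d%:R (fun f g => moment mu A (f \o p) g)
  (fun k f g => moment mu A (f \o (tperm j k * p)%g) g)).
etransitivity; last exact: esym (gather (\tr (A j))
  (fun f g => moment mu [eta A with j |-> 1%:M] (f \o p) g)
  (fun k f g => moment mu [eta A with j |-> A k *m A j, k |-> 1%:M]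
     (f \o (tperm j k * p)%g) g)).
apply: eq_bigr => f _; apply: eq_bigr => g _.
have SD := moment_schwinger_dyson mu_haar A j (f \o p) g.
apply: (congr1 (fun x => x * \prod_k B k (g k) (f k))).
etransitivity; last etransitivity; [|exact: SD|].
  apply: (congr1 (fun x => _ + x)); apply: eq_bigr => k _.
  exact: (congr1 (fun h => moment mu A h g) (comp f k)).
apply: (congr1 (fun x => _ + x)); apply: eq_bigr => k _.
exact: (congr1 (fun h => moment mu _ h g) (esym (comp f k))).
Qed.

End correlator.

(** * Norm estimates *)

Section slot_systems.
Variables (R : realType) (d n : nat).
Hypothesis d_ge16 : (16 <= d)%N.
Local Notation C := R[i].
Local Notation N := (@ComplexField.Normc.normc R).
Local Notation dR := (d%:R : R).
Implicit Types (p t : 'S_n) (b y w : 'S_n -> C).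

Let normC_normc (x : C) : `|x| = (N x)%:C.
Proof. by []. Qed.

Let ND (x y : C) : N (x + y) <= N x + N y.
Proof. by rewrite -lecR rmorphD; exact: (ler_normD x y). Qed.

Let NM (x y : C) : N (x * y) = N x * N y.
Proof. exact: ComplexField.Normc.normcM. Qed.

Let NN (x : C) : N (- x) = N x.
Proof. by apply: complexI; rewrite -!normC_normc normrN. Qed.

Let Nnat (k : nat) : N k%:R = k%:R.
Proof. by apply: complexI; rewrite -normC_normc normr_nat rmorph_nat. Qed.

Let N_ge0 (x : C) : 0 <= N x.
Proof. by rewrite -ler0c -normC_normc. Qed.

Let dR16 : 16%:R <= dR.
Proof. by rewrite ler_nat. Qed.

Let dR2 : 256%:R <= dR ^+ 2.
Proof. by rewrite -natrX ler_nat -[256%N]/(16 ^ 2)%N leq_exp2r. Qed.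

Let Nd2B1 : N (d%:R ^+ 2 - 1) = dR ^+ 2 - 1.
Proof.
have -> : d%:R ^+ 2 - 1 = (d ^ 2 - 1)%N%:R :> C.
  by rewrite natrB ?natrX // expn_gt0 (leq_trans _ d_ge16).
by rewrite Nnat natrB ?natrX // expn_gt0 (leq_trans _ d_ge16).
Qed.

(** The equations at [p] and [t * p] form a 2 by 2 linear system of determinant [d ^ 2 - 1]. *)
Lemma two_slot_solution t b y (c : C) : (t * t = 1)%g ->
  (forall p, d%:R * y p + y (t * p)%g = c * b (t * p)%g) ->
  forall p, (d%:R ^+ 2 - 1) * y p = c * (d%:R * b (t * p)%g - b p).
Proof.
move=> tt eqn p.
have E1 := eqn p; have := eqn (t * p)%g; rewrite mulgA tt mul1g => E2.
by rewrite mulrBr -E2 mulrCA -E1; ring.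
Qed.

Section two_slots.
Variables (t : 'S_n) (b y : 'S_n -> C) (c : C).
Hypotheses (tt : (t * t = 1)%g) (t_odd : odd_perm t).
Hypotheses (c_le1 : N c <= 1) (b_le : forall p, N (b p) <= dR ^+ 2)
  (b_odd : forall p, odd_perm p -> N (b p) <= dR)
  (eqn : forall p, d%:R * y p + y (t * p)%g = c * b (t * p)%g).

Let two_slot_norm p :
  (dR ^+ 2 - 1) * N (y p) <= dR * N (b (t * p)%g) + N (b p).
Proof.
rewrite -Nd2B1 -NM (two_slot_solution tt eqn) NM.
apply: le_trans (_ : N (d%:R * b (t * p)%g - b p) <= _).
  by rewrite ler_piMl.
by apply: le_trans (ND _ _) _; rewrite NN NM Nnat.
Qed.

(** Since [t * p] is odd, both terms of the solution are at most [d ^ 2], and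
    [2 d ^ 2 / (d ^ 2 - 1)] is at most 3. *)
Lemma two_slot_even p : ~~ odd_perm p -> N (y p) <= 3%:R.
Proof.
move=> pe; have := two_slot_norm p; have := b_le p.
have := @b_odd (t * p)%g; rewrite odd_permM t_odd (negPf pe) => /(_ isT).
set u := N (y p); set x := N _; set z := N _ => xd zd E.
have {E} : (dR ^+ 2 - 1) * u <= 2%:R * dR ^+ 2.
  by apply: le_trans E _; move: dR16; nra.
by move: dR2; set S := dR ^+ 2; nra.
Qed.

Lemma two_slot_le p : N (y p) <= 2%:R * dR.
Proof.
have [po|pe] := boolP (odd_perm p); last first.
  by apply: le_trans (two_slot_even pe) _; move: dR16; lra.
have := two_slot_norm p; have := b_odd po; have := b_le (t * p)%g.
move: (N_ge0 (y p)) dR16; set u := N _; set x := N _; set z := N _.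
move=> u0 d16 xd zd E.
have {E} : (dR ^+ 2 - 1) * u <= (dR ^+ 2 + 1) * dR.
  by apply: le_trans E _; nra.
by move: dR2; set S := dR ^+ 2 => S256 E; nra.
Qed.

(** The leading term vanishes, which leaves at most [d / (d ^ 2 - 1)]. *)
Lemma two_slot_odd p : odd_perm p -> b (t * p)%g = 0 -> dR * N (y p) <= 2%:R.
Proof.
move=> po bt0; have := two_slot_norm p; have := b_odd po.
rewrite bt0 ComplexField.Normc.normc0 mulr0 add0r.
set u := N (y p); set z := N _ => zd E.
have {E} : (dR ^+ 2 - 1) * (dR * u) <= dR ^+ 2.
  by rewrite mulrCA expr2 ler_wpM2l // (le_trans E).
by move: dR2; set S := dR ^+ 2; set du := dR * u => S256 E; nra.
Qed.

End two_slots.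

Let sup_norm (f : 'S_n -> C) : exists p, forall q, N (f q) <= N (f p).
Proof.
exists [arg max_(p > 1%g : 'S_n) N (f p)]%O.
by case: arg_maxP => // p _ le q; exact: le.
Qed.

Section three_slots.
Variables (t1 t2 : 'S_n) (y1 y2 w : 'S_n -> C).
Hypotheses (t1_odd : odd_perm t1) (t2_odd : odd_perm t2).
Hypotheses (y1_even : forall p, ~~ odd_perm p -> N (y1 p) <= 3%:R)
  (y2_even : forall p, ~~ odd_perm p -> N (y2 p) <= 3%:R)
  (y1_le : forall p, N (y1 p) <= 2%:R * dR) (y2_le : forall p, N (y2 p) <= 2%:R * dR).
Hypothesis eqn : forall p, d%:R * w p + w (t1 * p)%g + w (t2 * p)%g =
  y1 (t1 * p)%g + y2 (t2 * p)%g.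

Let three_slot_norm p : dR * N (w p) <=
  N (w (t1 * p)%g) + N (w (t2 * p)%g) + N (y1 (t1 * p)%g) + N (y2 (t2 * p)%g).
Proof.
have -> : dR * N (w p) = N (d%:R * w p) by rewrite NM Nnat.
have -> : d%:R * w p =
    - w (t1 * p)%g - w (t2 * p)%g + y1 (t1 * p)%g + y2 (t2 * p)%g.
  by rewrite -addrA -eqn; ring.
apply: le_trans (ND _ _) _; rewrite lerD2r; apply: le_trans (ND _ _) _.
by rewrite lerD2r; apply: le_trans (ND _ _) _; rewrite !NN.
Qed.

(** At a permutation where [w] is largest, the equation bounds this maximum by [4 d / (d - 2)]. *)
Lemma three_slot_le p : N (w p) <= 5%:R.
Proof.
have [q qmax] := sup_norm w; apply: le_trans (qmax p) _.
have := three_slot_norm q; move: (qmax (t1 * q)%g) (qmax (t2 * q)%g).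
move: (y1_le (t1 * q)%g) (y2_le (t2 * q)%g) (N_ge0 (w q)) dR16.
by nra.
Qed.

(** The neighbours of [p] are even, so the sources are at most 3 each: [16 = 5 + 5 + 3 + 3]. *)
Lemma three_slot_odd p : odd_perm p -> dR * N (w p) <= 16%:R.
Proof.
move=> po; have := three_slot_norm p.
move: (three_slot_le (t1 * p)%g) (three_slot_le (t2 * p)%g).
have := @y1_even (t1 * p)%g; rewrite odd_permM t1_odd po => /(_ isT).
have := @y2_even (t2 * p)%g; rewrite odd_permM t2_odd po => /(_ isT).
lra.
Qed.

(** One more factor [d] is gained from the odd neighbours: [36 = 16 + 16 + 2 + 2]. *)
Lemma three_slot_even p : ~~ odd_perm p ->
  dR * N (y1 (t1 * p)%g) <= 2%:R -> dR * N (y2 (t2 * p)%g) <= 2%:R ->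
  dR ^+ 2 * N (w p) <= 36%:R.
Proof.
move=> pe y1p y2p; have := three_slot_norm p.
have := @three_slot_odd (t1 * p)%g; rewrite odd_permM t1_odd (negPf pe) => /(_ isT).
have := @three_slot_odd (t2 * p)%g; rewrite odd_permM t2_odd (negPf pe) => /(_ isT).
move: dR16; nra.
Qed.

End three_slots.

Section four_slots.
Variables (s t1 t2 t3 g : 'S_n) (b u v w1 w3 : 'S_n -> C).
Hypotheses (ss : (s * s = 1)%g) (s_odd : odd_perm s) (g_odd : odd_perm g).
Hypotheses (t1_odd : odd_perm t1) (t2_odd : odd_perm t2) (t3_odd : odd_perm t3).
Hypothesis t2t2 : (t2 * t2 = 1)%g.
Hypotheses (b_le : forall p, N (b p) <= dR ^+ 2)
  (b_odd : forall p, odd_perm p -> N (b p) <= dR).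
Hypotheses (w1_le : forall p, N (w1 p) <= 5%:R) (w3_le : forall p, N (w3 p) <= 5%:R)
  (w1_odd : forall p, odd_perm p -> dR * N (w1 p) <= 16%:R)
  (w3_odd : forall p, odd_perm p -> dR * N (w3 p) <= 16%:R)
  (w1_g : dR ^+ 2 * N (w1 (t1 * g)%g) <= 36%:R)
  (w3_g : dR ^+ 2 * N (w3 (t3 * g)%g) <= 36%:R).
Hypothesis v_eqn : forall p, d%:R * v p + v (s * p)%g = 1 * b (s * p)%g.
Hypothesis u_eqn : forall p,
  d%:R * u p + u (t1 * p)%g + u (t2 * p)%g + u (t3 * p)%g =
  w1 (t1 * p)%g + v (t2 * p)%g + w3 (t3 * p)%g.
Hypotheses (b_g : b g = d%:R) (b_sg : b (s * g)%g = d%:R ^+ 2)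
  (b_t2g : b (t2 * g)%g = 0) (b_st2g : b (s * (t2 * g))%g = d%:R)
  (b_st2t1g : b (s * (t2 * (t1 * g)))%g = 0)
  (b_st2t3g : b (s * (t2 * (t3 * g)))%g = 0).

Let N1 : N 1 <= 1.
Proof. by rewrite (Nnat 1). Qed.

Let v_even := two_slot_even ss s_odd N1 b_le b_odd v_eqn.
Let v_le := two_slot_le ss s_odd N1 b_le b_odd v_eqn.
Let v_odd := two_slot_odd ss N1 b_odd v_eqn.

Let N3 (x y z : C) : N (x + y + z) <= N x + N y + N z.
Proof. by apply: le_trans (ND _ _) _; rewrite lerD2r. Qed.

Let r p := w1 (t1 * p)%g + v (t2 * p)%g + w3 (t3 * p)%g.

Let u_norm p : dR * N (u p) <=
  N (r p) + (N (u (t1 * p)%g) + N (u (t2 * p)%g) + N (u (t3 * p)%g)).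
Proof.
have -> : dR * N (u p) = N (d%:R * u p) by rewrite NM Nnat.
have -> : d%:R * u p = r p - (u (t1 * p)%g + u (t2 * p)%g + u (t3 * p)%g).
  by rewrite /r -u_eqn; ring.
by apply: le_trans (ND _ _) _; rewrite NN lerD2l; exact: N3.
Qed.

Let r_odd p : odd_perm p -> N (r p) <= 13%:R.
Proof.
move=> po; apply: le_trans (N3 _ _ _) _.
have := @v_even (t2 * p)%g; rewrite odd_permM t2_odd po => /(_ isT).
by move: (w1_le (t1 * p)%g) (w3_le (t3 * p)%g); lra.
Qed.

(** At the maximum, [(d - 3) * N (u q)] is at most [2 d + 10]. *)
Let u_le p : N (u p) <= 4%:R.
Proof.
have [q qmax] := sup_norm u; apply: le_trans (qmax p) _.
have rq : N (r q) <= 2%:R * dR + 10%:R.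
  apply: le_trans (N3 _ _ _) _.
  by move: (w1_le (t1 * q)%g) (w3_le (t3 * q)%g) (v_le (t2 * q)%g); lra.
have := u_norm q; move: (qmax (t1 * q)%g) (qmax (t2 * q)%g) (qmax (t3 * q)%g).
by move: (N_ge0 (u q)) dR16; nra.
Qed.

Let u_odd p : odd_perm p -> dR * N (u p) <= 25%:R.
Proof.
move=> po; have := u_norm p; have := r_odd po.
by move: (u_le (t1 * p)%g) (u_le (t2 * p)%g) (u_le (t3 * p)%g); lra.
Qed.

(** Exact, because [d * d ^ 2 - d = d * (d ^ 2 - 1)]. *)
Let v_g : v g = d%:R.
Proof.
have d0 : d%:R ^+ 2 - 1 != 0 :> C.
  apply/eqP => /(congr1 N); rewrite Nd2B1 ComplexField.Normc.normc0 => /eqP.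
  by move: dR2 => ? /eqP; lra.
apply: (mulfI d0); rewrite (two_slot_solution ss v_eqn) b_sg b_g; ring.
Qed.

(* The contributions of order [1] to [d * r g] and to the sum of the [r (tk * g)]
   cancel exactly up to [d / (d ^ 2 - 1)]. *)
Let v_cancel : dR * N (d%:R * v (t2 * g)%g - v g) <= 2%:R.
Proof.
have := two_slot_solution ss v_eqn (t2 * g)%g; rewrite b_st2g b_t2g subr0 mul1r => E.
have : (dR ^+ 2 - 1) * N (d%:R * v (t2 * g)%g - v g) = dR.
  rewrite -Nd2B1 -NM mulrBr mulrCA E v_g.
  rewrite (_ : _ - _ = d%:R); first exact: Nnat.
  ring.
set x := N _ => Ex; have x0 : 0 <= x by exact: N_ge0.
have : (dR ^+ 2 - 1) * (dR * x) = dR ^+ 2 by rewrite mulrCA Ex expr2.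
by move: dR2; set S := dR ^+ 2; set dx := dR * x => S256 {}Ex; nra.
Qed.

(** Applying [u_eqn] at [g] and then at its three neighbours expresses [d ^ 2 * u g] by sources and
    by values of [u] two steps away, which are small because those permutations are odd. The source
    [v (t2 * g)] appears with factor [d], and [v g] comes back with a minus sign since [t2] is an
    involution; [v_cancel] treats the pair. *)
Lemma four_slot_bound : dR ^+ 3 * N (u g) <= 399%:R.
Proof.
have odd2 (p q : 'S_n) : odd_perm p -> odd_perm q -> odd_perm (p * (q * g))%g.
  by move=> po qo; rewrite !odd_permM po qo g_odd.
have r_small (t : 'S_n) : odd_perm t -> b (s * (t2 * (t * g)))%g = 0 ->
    dR * N (r (t * g)%g) <= 34%:R.
  move=> t_odd bt; have vt := v_odd (odd2 _ _ t2_odd t_odd) bt.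
  have w1t := w1_odd (odd2 _ _ t1_odd t_odd); have w3t := w3_odd (odd2 _ _ t3_odd t_odd).
  have : dR * N (r (t * g)%g) <= dR * (N (w1 (t1 * (t * g))%g) +
      N (v (t2 * (t * g))%g) + N (w3 (t3 * (t * g))%g)).
    by apply: ler_wpM2l; [exact: ler0n|exact: N3].
  lra.
have r1 := r_small _ t1_odd b_st2t1g; have r3 := r_small _ t3_odd b_st2t3g.
have w1t := w1_odd (odd2 _ _ t1_odd t2_odd); have w3t := w3_odd (odd2 _ _ t3_odd t2_odd).
pose uu t := u (t1 * (t * g))%g + u (t2 * (t * g))%g + u (t3 * (t * g))%g.
have uu_small t : odd_perm t -> dR * N (uu t) <= 75%:R.
  move=> t_odd; move: (u_odd (odd2 _ _ t1_odd t_odd)) (u_odd (odd2 _ _ t2_odd t_odd))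
    (u_odd (odd2 _ _ t3_odd t_odd)).
  have : dR * N (uu t) <= dR * (N (u (t1 * (t * g))%g) +
      N (u (t2 * (t * g))%g) + N (u (t3 * (t * g))%g)).
    by apply: ler_wpM2l; [exact: ler0n|exact: N3].
  lra.
have u1 := uu_small _ t1_odd; have u2 := uu_small _ t2_odd; have u3 := uu_small _ t3_odd.
have expansion : d%:R ^+ 2 * u g =
    (d%:R * w1 (t1 * g)%g + d%:R * w3 (t3 * g)%g + (d%:R * v (t2 * g)%g - v g)) +
    (uu t1 + uu t2 + uu t3) +
    - (r (t1 * g)%g + r (t3 * g)%g + (w1 (t1 * (t2 * g))%g + w3 (t3 * (t2 * g))%g)).
  have t2K : (t2 * (t2 * g) = g)%g by rewrite mulgA t2t2 mul1g.
  have e0 : d%:R * u g = r g - u (t1 * g)%g - u (t2 * g)%g - u (t3 * g)%g.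
    by rewrite /r -u_eqn; ring.
  have e t : d%:R * u (t * g)%g = r (t * g)%g - uu t by rewrite /r -u_eqn /uu; ring.
  rewrite expr2 -mulrA e0 !mulrBr !e /r t2K; ring.
have {expansion} bound : dR ^+ 2 * N (u g) <=
   (dR * N (w1 (t1 * g)%g) + dR * N (w3 (t3 * g)%g) +
   N (d%:R * v (t2 * g)%g - v g)) + (N (uu t1) + N (uu t2) + N (uu t3)) +
   (N (r (t1 * g)%g) + N (r (t3 * g)%g) +
   (N (w1 (t1 * (t2 * g))%g) + N (w3 (t3 * (t2 * g))%g))).
  have -> : dR ^+ 2 * N (u g) = N (d%:R ^+ 2 * u g) by rewrite NM expr2 NM !Nnat.
  rewrite expansion; apply: le_trans (N3 _ _ _) _; rewrite NN !lerD //.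
  - by apply: le_trans (N3 _ _ _) _; rewrite !NM !Nnat.
  - apply: le_trans (ND _ _) _; rewrite lerD //.
(* After multiplication by [d]: [399 = 36 + 36 + 2 + 3 * 75 + 2 * 34 + 16 + 16]. *)
rewrite exprS -mulrA; apply: le_trans (ler_wpM2l (ler0n _ _) bound) _.
move: v_cancel w1_g w3_g; rewrite !mulrDr !mulrA -!expr2; lra.
Qed.

End four_slots.

End slot_systems.

(** * Permutations of four points *)

Local Notation o0 := (Ordinal (isT : (0 < 4)%N)).
Local Notation o1 := (Ordinal (isT : (1 < 4)%N)).
Local Notation o2 := (Ordinal (isT : (2 < 4)%N)).
Local Notation o3 := (Ordinal (isT : (3 < 4)%N)).

Lemma ord4P (k : 'I_4) : [\/ k = o0, k = o1, k = o2 | k = o3].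
Proof.
case: k => [[|[|[|[|//]]]] k4].
- by apply: Or41; apply: val_inj.
- by apply: Or42; apply: val_inj.
- by apply: Or43; apply: val_inj.
- by apply: Or44; apply: val_inj.
Qed.

Definition cycle4 : 'S_4 := (tperm o0 o1 * tperm o1 o2 * tperm o2 o3)%g.
Definition double_swap : 'S_4 := (tperm o0 o1 * tperm o2 o3)%g.

Lemma odd_cycle4 : odd_perm cycle4.
Proof. by rewrite !odd_permM !odd_tperm. Qed.

Lemma odd_double_swap : odd_perm double_swap = false.
Proof. by rewrite !odd_permM !odd_tperm. Qed.

Local Ltac values :=
  rewrite ?conjMg ?tpermJ ?permM ?permE /=; let k := fresh in
  apply/permP => k; rewrite ?permM; case: (ord4P k) => ->;
  repeat match goal with e : _ = _ |- _ => rewrite e; clear e end;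
  rewrite ?permE /=.

(** Without fixed points the cycle type is 4 or 2 + 2. The tables of values are enumerated and
    matched with explicit conjugators. *)
Lemma perm4_cases (p : 'S_4) :
  [\/ exists k, p k = k, exists s, p = (cycle4 ^ s)%g | exists s, p = (double_swap ^ s)%g].
Proof.
have ne (i j : 'I_4) : p i = p j -> i != j -> False.
  by move=> /perm_inj ->; rewrite eqxx.
case: (ord4P (p o0)) => e0; first (by apply: Or31; exists o0);
case: (ord4P (p o1)) => e1; try (by apply: Or31; exists o1);
try (by case: (ne o0 o1); rewrite ?e0 ?e1);
case: (ord4P (p o2)) => e2; try (by apply: Or31; exists o2);
try (by case: (ne o0 o2); rewrite ?e0 ?e2);
try (by case: (ne o1 o2); rewrite ?e1 ?e2);
case: (ord4P (p o3)) => e3; try (by apply: Or31; exists o3);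
try (by case: (ne o0 o3); rewrite ?e0 ?e3);
try (by case: (ne o1 o3); rewrite ?e1 ?e3);
try (by case: (ne o2 o3); rewrite ?e2 ?e3).
1: by apply: Or33; exists 1%g; rewrite conjg1; values.
all: try (by apply: Or33; exists (tperm o1 o2); values).
all: try (by apply: Or33; exists (tperm o1 o3); values).
all: try (by apply: Or32; exists 1%g; rewrite conjg1; values).
all: try (by apply: Or32; exists (tperm o1 o2); values).
all: try (by apply: Or32; exists (tperm o2 o3); values).
all: try (by apply: Or32; exists (tperm o1 o3); values).
all: try (by apply: Or32; exists (tperm o1 o2 * tperm o2 o3)%g; values).
all: by apply: Or32; exists (tperm o2 o3 * tperm o1 o2)%g; values.
Qed.

(** * Twisted traces of four matrices *)

Section traces.
Variables (K : comNzRingType) (d : nat).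
Implicit Types (Y : 'I_4 -> 'M[K]_d) (p : 'S_4).

Let quad (x0 x1 x2 x3 : 'I_d) (k : 'I_4) : 'I_d := nth x0 [:: x0; x1; x2; x3] k.

(** The summation order, [x3] outermost, is that of the trace of a product associated to the
    left. *)
Let sum_ffun4 (F : ('I_4 -> 'I_d) -> K) :
  \sum_(f : {ffun 'I_4 -> 'I_d}) F f =
  \sum_(x3 < d) \sum_(x2 < d) \sum_(x1 < d) \sum_(x0 < d) F (quad x0 x1 x2 x3).
Proof.
pose T := ('I_d * 'I_d * ('I_d * 'I_d))%type.
transitivity (\sum_(x : T) F (quad x.2.2 x.2.1 x.1.2 x.1.1)); last first.
  rewrite -(pair_bigA _ (fun x y => F (quad y.2 y.1 x.2 x.1))) /=.
  rewrite -(pair_bigA _ (fun x3 x2 => \sum_y F (quad y.2 y.1 x2 x3))) /=.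
  apply: eq_bigr => x3 _; apply: eq_bigr => x2 _.
  by rewrite -(pair_bigA _ (fun x1 x0 => F (quad x0 x1 x2 x3))).
rewrite (reindex (fun x : T => [ffun k => quad x.2.2 x.2.1 x.1.2 x.1.1 k])) /=.
  by apply: eq_bigr => x _; congr F; apply/funext => k; rewrite ffunE.
exists (fun f : {ffun 'I_4 -> 'I_d} => ((f o3, f o2), (f o1, f o0))).
  by move=> [[x3 x2] [x1 x0]] _; rewrite !ffunE.
by move=> f _; apply/ffunP => k; rewrite ffunE; case: (ord4P k) => ->.
Qed.

Let prod_ord4 (F : 'I_4 -> K) : \prod_k F k = F o0 * F o1 * F o2 * F o3.
Proof.
rewrite !big_ord_recl big_ord0 mulr1 !mulrA.
by congr (F _ * F _ * F _ * F _); apply/val_inj.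
Qed.

(** [cycle4] sends [k] to [k - 1] modulo 4, so the column index of each matrix is the row index of
    the next. *)
Lemma twisted_trace_cycle4 Y :
  twisted_trace Y cycle4 = \tr (Y o0 *m Y o1 *m Y o2 *m Y o3).
Proof.
rewrite /twisted_trace (sum_ffun4 (fun f => \prod_k Y k (f (cycle4 k)) (f k))).
apply: eq_bigr => x3 _; rewrite mxE; apply: eq_bigr => x2 _.
rewrite mxE mulr_suml; apply: eq_bigr => x1 _.
rewrite mxE !mulr_suml; apply: eq_bigr => x0 _.
by rewrite prod_ord4 !permM !permE.
Qed.

Lemma twisted_trace_double_swap Y :
  twisted_trace Y double_swap = \tr (Y o0 *m Y o1) * \tr (Y o2 *m Y o3).
Proof.
rewrite /twisted_trace (sum_ffun4 (fun f => \prod_k Y k (f (double_swap k)) (f k))).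
rewrite mulrC mulr_suml; apply: eq_bigr => x3 _.
rewrite mxE mulr_suml; apply: eq_bigr => x2 _.
rewrite mulr_sumr; apply: eq_bigr => x1 _.
rewrite mxE mulr_sumr; apply: eq_bigr => x0 _.
rewrite prod_ord4 !permM !permE /=; ring.
Qed.

Let twisted_trace_fix0 Y p : p o0 = o0 -> \tr (Y o0) = 0 -> twisted_trace Y p = 0.
Proof.
move=> p0 Y0; rewrite /twisted_trace (sum_ffun4 (fun f => \prod_k Y k (f (p k)) (f k))).
apply: big1 => x3 _; apply: big1 => x2 _; apply: big1 => x1 _.
(* The first [x1] is only a placeholder: for [k] other than [o0], [p k] is never [o0]. *)
pose q := quad x1 x1 x2 x3.
transitivity (\sum_x0 Y o0 x0 x0 *
   (Y o1 (q (p o1)) x1 * Y o2 (q (p o2)) x2 * Y o3 (q (p o3)) x3)); last first.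
  by rewrite -mulr_suml [X in X * _]Y0 mul0r.
apply: eq_bigr => x0 _; rewrite prod_ord4 p0 !mulrA.
have qE k : k != o0 -> quad x0 x1 x2 x3 (p k) = q (p k).
  move=> k0; have : p k != o0 by rewrite -p0 (inj_eq perm_inj).
  by case: (ord4P (p k)) => ->.
by rewrite !qE.
Qed.

(** A fixed point splits off the trace of its matrix as a factor; a conjugation moves it to slot
    0. *)
Lemma twisted_trace_fixed Y p k : p k = k -> \tr (Y k) = 0 -> twisted_trace Y p = 0.
Proof.
move=> pk Yk; set s := tperm o0 k.
have -> : p = ((p ^ s) ^ s)%g by rewrite -conjgM /s tperm2 conjg1.
rewrite twisted_trace_conj; apply: twisted_trace_fix0; last by rewrite /= tpermL.
by rewrite /conjg !permM tpermV tpermL pk tpermR.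
Qed.

End traces.

(** * Pauli operators *)

Section pauli_algebra.
Variable R : realType.
Local Notation C := R[i].
Local Notation L := [:: 1%:M; pauliX R; pauliY R; pauliZ R].

Lemma castmx_mulmx (K : pzSemiRingType) m n (e : m = n) (A B : 'M[K]_m) :
  castmx (e, e) A *m castmx (e, e) B = castmx (e, e) (A *m B).
Proof. by case: n / e; rewrite !castmx_id. Qed.

Lemma mxtrace_castmx (K : pzSemiRingType) m n (e : m = n) (A : 'M[K]_m) :
  \tr (castmx (e, e) A) = \tr A.
Proof. by case: n / e; rewrite castmx_id. Qed.

Lemma mxtrace_tensmx (K : comNzRingType) m n (A : 'M[K]_m) (B : 'M[K]_n) :
  \tr (tensmx A B) = \tr A * \tr B.
Proof.
rewrite /mxtrace mulr_sum; apply: eq_bigr => i _.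
by case: (mxtens_indexP i) => i1 i2; rewrite tensmxE mxtens_indexK.
Qed.

Lemma tensmx1 (K : comNzRingType) m n :
  tensmx (1%:M : 'M[K]_m) (1%:M : 'M[K]_n) = 1%:M.
Proof.
apply/matrixP => i j; case: (mxtens_indexP i) => i1 i2; case: (mxtens_indexP j) => j1 j2.
rewrite tensmxE !mxE (inj_eq (can_inj (@mxtens_indexK m n))) xpair_eqE.
by rewrite -natrM mulnb.
Qed.

Lemma tens_prod_mul n (P Q : 'I_n -> 'M[C]_2) :
  tens_prod P *m tens_prod Q = tens_prod (fun i => P i *m Q i).
Proof.
elim: n P Q => [|n IH] P Q /=; first by rewrite mulmx1.
by rewrite castmx_mulmx tensmx_mul IH.
Qed.

Lemma mxtrace_tens_prod n (P : 'I_n -> 'M[C]_2) :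
  \tr (tens_prod P) = \prod_i \tr (P i).
Proof.
elim: n P => [|n IH] P /=; first by rewrite big_ord0 mxtrace1.
by rewrite mxtrace_castmx mxtrace_tensmx IH big_ord_recl.
Qed.

Lemma tens_prod1 n : tens_prod (fun _ : 'I_n => 1%:M : 'M[C]_2) = 1%:M.
Proof.
elim: n => [|n IH] //=; rewrite IH tensmx1.
by move: (esym _) => e; case: _ / e; rewrite castmx_id.
Qed.

Lemma tens_prod_adj n (P : 'I_n -> 'M[C]_2) :
  (tens_prod P)^t* = tens_prod (fun i => (P i)^t*).
Proof.
elim: n P => [|n IH] P /=; first by rewrite trmx1 map_mx1.
by rewrite trmx_cast map_castmx trmx_tens map_mxT IH.
Qed.

Lemma pauli_matrix_adj (P : 'M[C]_2) : P \in L -> P^t* = P.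
Proof.
rewrite !inE => /or4P[] /eqP ->; first by rewrite trmx1 map_mx1.
all: apply/matrixP => i j; rewrite !mxE.
all: case: i => [[|[|//]] ?]; case: j => [[|[|//]] ?]; apply/eqP; rewrite eq_complex /=.
all: by rewrite ?oppr0 ?opprK !eqxx.
Qed.

Lemma pauli_matrix_sqr (P : 'M[C]_2) : P \in L -> P *m P = 1%:M.
Proof.
rewrite !inE => /or4P[] /eqP ->; first by rewrite mulmx1.
all: apply/matrixP => i j; rewrite !mxE !big_ord_recl big_ord0 !mxE.
all: case: i => [[|[|//]] ?]; case: j => [[|[|//]] ?]; apply/eqP; rewrite eq_complex /=.
all: rewrite ?(mulr0, mul0r, mulr1, mul1r, mulN1r, mulrN1, addr0, add0r, opprK,
  oppr0, subr0, sub0r).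
all: by rewrite ?eqxx.
Qed.

Lemma pauli_matrix_orthogonal (P Q : 'M[C]_2) :
  P \in L -> Q \in L -> P != Q -> \tr (P *m Q) = 0.
Proof.
rewrite !inE => /or4P[] /eqP -> /or4P[] /eqP ->; rewrite ?eqxx // => _.
all: rewrite ?mul1mx ?mulmx1 /mxtrace !big_ord_recl big_ord0.
all: rewrite !mxE ?big_ord_recl ?big_ord0 ?mxE /=.
all: apply/eqP; rewrite eq_complex /=.
all: rewrite ?(mulr0, mul0r, mulr1, mul1r, mulN1r, mulrN1, addr0, add0r, opprK,
  oppr0, subr0, sub0r).
all: by rewrite ?(addrN, addNr) ?eqxx.
Qed.

Lemma pauli_operator1 n : pauli_operator (1%:M : 'M[C]_(2 ^ n)).
Proof.
exists (fun=> 1%:M); last by rewrite tens_prod1.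
by move=> j; rewrite inE eqxx.
Qed.

Lemma pauli_operator_adj n (A : 'M[C]_(2 ^ n)) : pauli_operator A -> A^t* = A.
Proof.
move=> [P PL ->]; rewrite tens_prod_adj; congr tens_prod.
by apply/funext => i; exact: pauli_matrix_adj.
Qed.

Lemma pauli_operator_sqr n (A : 'M[C]_(2 ^ n)) : pauli_operator A -> A *m A = 1%:M.
Proof.
move=> [P PL ->]; rewrite tens_prod_mul -tens_prod1; congr tens_prod.
by apply/funext => i; exact: pauli_matrix_sqr.
Qed.

(** If all tensor factors agree, the product is the identity; otherwise some factor of the product
    has trace zero. *)
Lemma pauli_operator_orthogonal n (A B : 'M[C]_(2 ^ n)) :
  pauli_operator A -> pauli_operator B -> A *m B <> 1%:M -> \tr (A *m B) = 0.
Proof.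
move=> [P PL ->] [Q QL ->]; rewrite tens_prod_mul => PQ1.
rewrite mxtrace_tens_prod; apply/eqP/prodf_eq0.
have [/existsP[i PQi]|] := boolP [exists i, P i != Q i].
  by exists i => //; rewrite (pauli_matrix_orthogonal (PL i) (QL i) PQi).
rewrite negb_exists => /forallP PQ; case: PQ1; rewrite -tens_prod1; congr tens_prod.
apply/funext => i; have := PQ i; rewrite negbK => /eqP ->.
exact: pauli_matrix_sqr.
Qed.

Lemma pauli_operator_traceless n (A : 'M[C]_(2 ^ n)) :
  pauli_operator A -> A <> 1%:M -> \tr A = 0.
Proof.
move=> pA A1; rewrite -[A]mulmx1; apply: pauli_operator_orthogonal => //.
  exact: pauli_operator1.
by rewrite mulmx1.
Qed.

Lemma pauli_operator_unitary n (A : 'M[C]_(2 ^ n)) :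
  pauli_operator A -> A \is unitarymx.
Proof.
by move=> pA; apply/unitarymxP; rewrite (pauli_operator_adj pA) (pauli_operator_sqr pA).
Qed.

End pauli_algebra.

(** * The eight-point correlator *)

Section four_slot_correlators.
Variables (R : realType) (d : nat).
Local Notation C := R[i].
Local Notation G := (unitary_borel R d).
Local Notation N := (@ComplexField.Normc.normc R).
Local Notation t01 := (tperm o0 o1).
Local Notation t02 := (tperm o0 o2).
Local Notation t03 := (tperm o0 o3).
Local Notation t13 := (tperm o1 o3).

Definition slots (X0 X1 X2 X3 : 'M[C]_d) (k : 'I_4) : 'M[C]_d :=
  nth 0 [:: X0; X1; X2; X3] k.

Lemma normc_trace_unitary (U : 'M[C]_d) : U \is unitarymx -> N (\tr U) <= d%:R.
Proof.
move=> Uu; rewrite -lecR rmorph_nat; change (`|\tr U| <= d%:R :> C).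
rewrite /mxtrace; apply: le_trans (ler_norm_sum _ _ _) _.
rewrite -[X in _ <= X%:R](card_ord d) -sumr_const; apply: ler_sum => i _.
exact: coef_unitary_le1.
Qed.

Section traceless_slots.
Variable B : 'I_4 -> 'M[C]_d.
Hypotheses (B_unitary : forall k, B k \is unitarymx) (B_tr : forall k, \tr (B k) = 0).

(** Fixed points give zero, so only the 4-cycles remain, each contributing a single trace of a
    unitary. *)
Lemma twisted_trace_odd (p : 'S_4) : odd_perm p -> N (twisted_trace B p) <= d%:R.
Proof.
case: (perm4_cases p) => [[k pk]|[s ->]|[s ->]] podd.
- by rewrite (twisted_trace_fixed pk (B_tr k)) ComplexField.Normc.normc0 ler0n.
- rewrite twisted_trace_conj twisted_trace_cycle4.
  by apply: normc_trace_unitary; rewrite !mul_unitarymx //=.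
- by move: podd; rewrite odd_permJ odd_double_swap.
Qed.

Lemma twisted_trace_le (p : 'S_4) : (0 < d)%N -> N (twisted_trace B p) <= d%:R ^+ 2.
Proof.
move=> d0; case: (perm4_cases p) => [[k pk]|[s sE]|[s ->]].
- by rewrite (twisted_trace_fixed pk (B_tr k)) ComplexField.Normc.normc0 exprn_ge0.
- apply: le_trans (twisted_trace_odd _) _; first by rewrite sE odd_permJ odd_cycle4.
  by rewrite -natrX ler_nat leq_pmull.
- rewrite twisted_trace_conj twisted_trace_double_swap ComplexField.Normc.normcM expr2.
  have N_ge0 (z : C) : 0 <= N z by rewrite -ler0c; exact: (normr_ge0 z).
  by apply: ler_pM => //; apply: normc_trace_unitary; rewrite mul_unitarymx //=.
Qed.

End traceless_slots.

Variable mu : probability G R.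
Hypothesis mu_haar : is_haar mu.
Variable B : 'I_4 -> 'M[C]_d.
Local Notation X X0 X1 X2 X3 p := (correlator mu B (slots X0 X1 X2 X3) p).

Let sum_neq0 (F : 'I_4 -> C) : \sum_(k | k != o0) F k = F o1 + F o2 + F o3.
Proof.
rewrite big_mkcond !big_ord_recl big_ord0 /= add0r addr0 !addrA.
by congr (F _ + F _ + F _); apply/val_inj.
Qed.

Let sum_neq1 (F : 'I_4 -> C) : \sum_(k | k != o1) F k = F o0 + F o2 + F o3.
Proof.
rewrite big_mkcond !big_ord_recl big_ord0 /= add0r addr0 !addrA.
by congr (F _ + F _ + F _); apply/val_inj.
Qed.

Let eq_slots (Y Z : 'I_4 -> 'M[C]_d) :
  Y o0 = Z o0 -> Y o1 = Z o1 -> Y o2 = Z o2 -> Y o3 = Z o3 -> Y = Z.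
Proof. by move=> *; apply/funext => k; case: (ord4P k) => ->. Qed.

Let schwinger_dyson0 A p :
  d%:R * correlator mu B A p + (correlator mu B A (tperm o0 o1 * p)%g +
    correlator mu B A (tperm o0 o2 * p)%g + correlator mu B A (tperm o0 o3 * p)%g) =
  \tr (A o0) * correlator mu B [eta A with o0 |-> 1%:M] p +
  (correlator mu B [eta A with o0 |-> A o1 *m A o0, o1 |-> 1%:M] (tperm o0 o1 * p)%g +
   correlator mu B [eta A with o0 |-> A o2 *m A o0, o2 |-> 1%:M] (tperm o0 o2 * p)%g +
   correlator mu B [eta A with o0 |-> A o3 *m A o0, o3 |-> 1%:M] (tperm o0 o3 * p)%g).
Proof.
have SD := correlator_schwinger_dyson mu_haar B A o0 p.
pose F k := correlator mu B A (tperm o0 k * p)%g.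
pose H k := correlator mu B [eta A with o0 |-> A k *m A o0, k |-> 1%:M] (tperm o0 k * p)%g.
exact: (etrans (congr1 (fun x => _ + x) (esym (sum_neq0 F)))
  (etrans SD (congr1 (fun x => _ + x) (sum_neq0 H)))).
Qed.

Let schwinger_dyson1 A p :
  d%:R * correlator mu B A p + (correlator mu B A (tperm o1 o0 * p)%g +
    correlator mu B A (tperm o1 o2 * p)%g + correlator mu B A (tperm o1 o3 * p)%g) =
  \tr (A o1) * correlator mu B [eta A with o1 |-> 1%:M] p +
  (correlator mu B [eta A with o1 |-> A o0 *m A o1, o0 |-> 1%:M] (tperm o1 o0 * p)%g +
   correlator mu B [eta A with o1 |-> A o2 *m A o1, o2 |-> 1%:M] (tperm o1 o2 * p)%g +
   correlator mu B [eta A with o1 |-> A o3 *m A o1, o3 |-> 1%:M] (tperm o1 o3 * p)%g).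
Proof.
have SD := correlator_schwinger_dyson mu_haar B A o1 p.
pose F k := correlator mu B A (tperm o1 k * p)%g.
pose H k := correlator mu B [eta A with o1 |-> A k *m A o1, k |-> 1%:M] (tperm o1 k * p)%g.
exact: (etrans (congr1 (fun x => _ + x) (esym (sum_neq1 F)))
  (etrans SD (congr1 (fun x => _ + x) (sum_neq1 H)))).
Qed.

Let slots_update X0 X1 X2 X3 (F : 'I_4 -> 'M[C]_d) p :
  F o0 = X0 -> F o1 = X1 -> F o2 = X2 -> F o3 = X3 ->
  correlator mu B F p = X X0 X1 X2 X3 p.
Proof. by move=> *; congr (correlator mu B _ p); apply: eq_slots. Qed.

Let add_mul_congr (a b0 c0 b1 c1 b2 c2 b3 c3 : C) :
  b0 = c0 -> b1 = c1 -> b2 = c2 -> b3 = c3 ->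
  a * b0 + (b1 + b2 + b3) = a * c0 + (c1 + c2 + c3).
Proof. by move=> -> -> -> ->. Qed.

Lemma slot0_equation X0 X1 X2 X3 p :
  d%:R * X X0 X1 X2 X3 p + (X X0 X1 X2 X3 (t01 * p)%g +
    X X0 X1 X2 X3 (t02 * p)%g + X X0 X1 X2 X3 (t03 * p)%g) =
  \tr X0 * X 1%:M X1 X2 X3 p + (X (X1 *m X0) 1%:M X2 X3 (t01 * p)%g +
    X (X2 *m X0) X1 1%:M X3 (t02 * p)%g + X (X3 *m X0) X1 X2 1%:M (t03 * p)%g).
Proof.
apply: (etrans (schwinger_dyson0 (slots X0 X1 X2 X3) p)).
by apply: add_mul_congr; exact: slots_update.
Qed.

Lemma slot1_equation X0 X1 X2 X3 p :
  d%:R * X X0 X1 X2 X3 p + (X X0 X1 X2 X3 (t01 * p)%g +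
    X X0 X1 X2 X3 (tperm o1 o2 * p)%g + X X0 X1 X2 X3 (t13 * p)%g) =
  \tr X1 * X X0 1%:M X2 X3 p + (X 1%:M (X0 *m X1) X2 X3 (t01 * p)%g +
    X X0 (X2 *m X1) 1%:M X3 (tperm o1 o2 * p)%g + X X0 (X3 *m X1) X2 1%:M (t13 * p)%g).
Proof.
rewrite (tpermC o0 o1); apply: (etrans (schwinger_dyson1 (slots X0 X1 X2 X3) p)).
by apply: add_mul_congr; exact: slots_update.
Qed.

Lemma correlator_slots1 p : X 1%:M 1%:M 1%:M 1%:M p = twisted_trace B p.
Proof.
by apply: (etrans _ (correlator1 mu B p)); congr (correlator mu B _ p); exact: eq_slots.
Qed.

End four_slot_correlators.

(** * Elimination of the slots one after the other *)

Section slot_reduction.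
Variables (R : realType) (d n : nat).
Local Notation C := R[i].
Local Notation N := (@ComplexField.Normc.normc R).
(** [X] stands for the correlator with [B] fixed. In the application [t1], [t2], [t3] exchange slot
    0 with slots 1, 2, 3, [s] exchanges 1 and 3, [r] exchanges 1 and 2, and [g] is the 4-cycle. *)
Variable X : 'M[C]_d -> 'M[C]_d -> 'M[C]_d -> 'M[C]_d -> 'S_n -> C.
Variables (t1 t2 t3 s r g : 'S_n) (b : 'S_n -> C).
Hypothesis slot0 : forall X0 X1 X2 X3 p,
  d%:R * X X0 X1 X2 X3 p + (X X0 X1 X2 X3 (t1 * p)%g +
    X X0 X1 X2 X3 (t2 * p)%g + X X0 X1 X2 X3 (t3 * p)%g) =
  \tr X0 * X 1%:M X1 X2 X3 p + (X (X1 *m X0) 1%:M X2 X3 (t1 * p)%g +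
    X (X2 *m X0) X1 1%:M X3 (t2 * p)%g + X (X3 *m X0) X1 X2 1%:M (t3 * p)%g).
Hypothesis slot1 : forall X0 X1 X2 X3 p,
  d%:R * X X0 X1 X2 X3 p + (X X0 X1 X2 X3 (t1 * p)%g +
    X X0 X1 X2 X3 (r * p)%g + X X0 X1 X2 X3 (s * p)%g) =
  \tr X1 * X X0 1%:M X2 X3 p + (X 1%:M (X0 *m X1) X2 X3 (t1 * p)%g +
    X X0 (X2 *m X1) 1%:M X3 (r * p)%g + X X0 (X3 *m X1) X2 1%:M (s * p)%g).
Hypothesis X1 : forall p, X 1%:M 1%:M 1%:M 1%:M p = b p.
Hypothesis d_ge16 : (16 <= d)%N.
Variables (A E : 'M[C]_d).
Hypotheses (A_unitary : A \is unitarymx) (E_unitary : E \is unitarymx).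
Hypotheses (AA : A *m A = 1%:M) (EE : E *m E = 1%:M).
Hypotheses (A_tr : \tr A = 0) (E_tr : \tr E = 0) (EA_tr : \tr (E *m A) = 0).
Hypotheses (t1t1 : (t1 * t1 = 1)%g) (t2t2 : (t2 * t2 = 1)%g)
  (t3t3 : (t3 * t3 = 1)%g) (ss : (s * s = 1)%g).
Hypotheses (t1_odd : odd_perm t1) (t2_odd : odd_perm t2) (t3_odd : odd_perm t3)
  (s_odd : odd_perm s) (g_odd : odd_perm g).
Hypotheses (b_le : forall p, N (b p) <= d%:R ^+ 2)
  (b_odd : forall p, odd_perm p -> N (b p) <= d%:R).

Let d_neq0 : d%:R != 0 :> C.
Proof. by rewrite pnatr_eq0 -lt0n (leq_trans _ d_ge16). Qed.

Let AEA := A *m (E *m A).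
(** For Pauli operators this is the sign by which [A] and [E] commute or anticommute; the bound
    [N c <= 1] treats both cases at once. *)
Let c : C := \tr (E *m AEA) / d%:R.

Let c_le1 : N c <= 1.
Proof.
rewrite /c ComplexField.Normc.normcM ComplexField.Normc.normcV.
have -> : N d%:R = d%:R.
  by apply: complexI; rewrite rmorph_nat; exact: (normr_nat C d).
rewrite ler_pdivrMr ?mul1r ?ltr0n ?(leq_trans _ d_ge16) //.
by apply: normc_trace_unitary; rewrite !mul_unitarymx.
Qed.

Let one_le1 : N 1 <= 1.
Proof. by rewrite ComplexField.Normc.normc1. Qed.

(** Merging with an identity slot returns the same correlator, so the transposition terms on the two
    sides cancel and only the trace term remains. *)
Let x_one p : X (E *m AEA) 1%:M 1%:M 1%:M p = c * b p.
Proof.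
have := slot0 (E *m AEA) 1%:M 1%:M 1%:M p.
rewrite !mul1mx => /addIr; rewrite X1 => H.
by apply: (mulfI d_neq0); rewrite H /c; field.
Qed.

Let AEA_tr : \tr AEA = 0.
Proof. by rewrite mxtrace_mulC -mulmxA AA mulmx1. Qed.

Let EEA : E *m (E *m A) = A.
Proof. by rewrite mulmxA EE mul1mx. Qed.

(** These three lemmas remove the terms of identity slots, which are equal on the two sides; the
    number names the slot that survives. *)
Let cancel3 (a x1 x2 x3 y : C) : a + (x1 + x2 + x3) = x1 + x2 + y -> a + x3 = y.
Proof. by move=> H; apply: (addrI (x1 + x2)); rewrite -H; ring. Qed.

Let cancel2 (a x1 x2 x3 y : C) : a + (x1 + x2 + x3) = x1 + y + x3 -> a + x2 = y.
Proof. by move=> H; apply: (addrI (x1 + x3)); rewrite [RHS]addrAC -H; ring. Qed.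

Let cancel1 (a x1 x2 x3 y : C) : a + (x1 + x2 + x3) = y + x2 + x3 -> a + x1 = y.
Proof. by move=> H; apply: (addIr (x2 + x3)); rewrite [RHS]addrA -H; ring. Qed.

Let first_last_equation p : d%:R * X AEA 1%:M 1%:M E p + X AEA 1%:M 1%:M E (t3 * p)%g =
  c * b (t3 * p)%g.
Proof.
have := slot0 AEA 1%:M 1%:M E p.
by rewrite !mul1mx AEA_tr mul0r add0r x_one => /cancel3.
Qed.

Let first_third_equation p : d%:R * X A 1%:M A 1%:M p + X A 1%:M A 1%:M (t2 * p)%g =
  1 * b (t2 * p)%g.
Proof.
have := slot0 A 1%:M A 1%:M p.
by rewrite !mul1mx A_tr mul0r add0r AA X1 mul1r => /cancel2.
Qed.

Let first_second_equation p : d%:R * X AEA E 1%:M 1%:M p + X AEA E 1%:M 1%:M (t1 * p)%g =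
  c * b (t1 * p)%g.
Proof.
have := slot0 AEA E 1%:M 1%:M p.
by rewrite !mul1mx AEA_tr mul0r add0r x_one => /cancel1.
Qed.

Let second_last_equation p : d%:R * X 1%:M E 1%:M E p + X 1%:M E 1%:M E (s * p)%g =
  1 * b (s * p)%g.
Proof.
have := slot1 1%:M E 1%:M E p.
by rewrite !mul1mx E_tr mul0r add0r EE X1 mul1r => /cancel3.
Qed.

Let w1_equation p : d%:R * X (E *m A) 1%:M A E p + X (E *m A) 1%:M A E (t2 * p)%g +
    X (E *m A) 1%:M A E (t3 * p)%g =
  X AEA 1%:M 1%:M E (t2 * p)%g + X A 1%:M A 1%:M (t3 * p)%g.
Proof.
have := slot0 (E *m A) 1%:M A E p.
rewrite !mul1mx EA_tr mul0r add0r EEA => H.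
apply: (addrI (X (E *m A) 1%:M A E (t1 * p)%g)).
by rewrite [RHS]addrA -H; ring.
Qed.

Let w3_equation p : d%:R * X (E *m A) E A 1%:M p + X (E *m A) E A 1%:M (t1 * p)%g +
    X (E *m A) E A 1%:M (t2 * p)%g =
  X A 1%:M A 1%:M (t1 * p)%g + X AEA E 1%:M 1%:M (t2 * p)%g.
Proof.
have := slot0 (E *m A) E A 1%:M p.
rewrite !mul1mx EA_tr mul0r add0r EEA => H.
apply: (addIr (X (E *m A) E A 1%:M (t3 * p)%g)).
by rewrite -H; ring.
Qed.

(** Merging slot 2 gives [A A = 1], while merging slots 1 and 3 gives [E A]: these are the sources
    [v], [w1] and [w3] of the four-slot system. *)
Let u_equation p : d%:R * X A E A E p + X A E A E (t1 * p)%g + X A E A E (t2 * p)%g +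
    X A E A E (t3 * p)%g =
  X (E *m A) 1%:M A E (t1 * p)%g + X 1%:M E 1%:M E (t2 * p)%g +
    X (E *m A) E A 1%:M (t3 * p)%g.
Proof.
have := slot0 A E A E p.
rewrite A_tr mul0r add0r AA => <-; ring.
Qed.

Hypotheses (b_g : b g = d%:R) (b_sg : b (s * g)%g = d%:R ^+ 2)
  (b_t2g : b (t2 * g)%g = 0) (b_st2g : b (s * (t2 * g))%g = d%:R)
  (b_st2t1g : b (s * (t2 * (t1 * g)))%g = 0)
  (b_st2t3g : b (s * (t2 * (t3 * g)))%g = 0)
  (b_t3t2t1g : b (t3 * (t2 * (t1 * g)))%g = 0)
  (b_t2t3t1g : b (t2 * (t3 * (t1 * g)))%g = 0)
  (b_t2t1t3g : b (t2 * (t1 * (t3 * g)))%g = 0)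
  (b_t1t2t3g : b (t1 * (t2 * (t3 * g)))%g = 0).

Lemma slot_reduction_bound : (d%:R : R) ^+ 3 * N (X A E A E g) <= 399%:R.
Proof.
have odd2 (p q : 'S_n) : odd_perm p -> odd_perm q -> odd_perm (p * (q * g))%g.
  by move=> po qo; rewrite !odd_permM po qo g_odd.
have even1 (p : 'S_n) : odd_perm p -> ~~ odd_perm (p * g)%g.
  by move=> po; rewrite odd_permM po g_odd.
have first_last_even := two_slot_even d_ge16
  t3t3 t3_odd c_le1 b_le b_odd first_last_equation.
have first_last_le := two_slot_le d_ge16 t3t3 t3_odd c_le1 b_le b_odd first_last_equation.
have first_last_odd := two_slot_odd d_ge16 t3t3 c_le1 b_odd first_last_equation.
have first_third_even := two_slot_even d_ge16
  t2t2 t2_odd one_le1 b_le b_odd first_third_equation.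
have first_third_le := two_slot_le d_ge16
  t2t2 t2_odd one_le1 b_le b_odd first_third_equation.
have first_third_odd := two_slot_odd d_ge16 t2t2 one_le1 b_odd first_third_equation.
have first_second_even := two_slot_even d_ge16
  t1t1 t1_odd c_le1 b_le b_odd first_second_equation.
have first_second_le := two_slot_le d_ge16
  t1t1 t1_odd c_le1 b_le b_odd first_second_equation.
have first_second_odd := two_slot_odd d_ge16 t1t1 c_le1 b_odd first_second_equation.
apply: (four_slot_bound d_ge16 ss s_odd g_odd t1_odd t2_odd t3_odd t2t2 b_le b_odd
  _ _ _ _ _ _ second_last_equation u_equation b_g b_sg b_t2g b_st2g b_st2t1g b_st2t3g).
- exact: (three_slot_le d_ge16 first_last_le first_third_le w1_equation).
- exact: (three_slot_le d_ge16 first_third_le first_second_le w3_equation).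
- exact: (three_slot_odd d_ge16 t2_odd t3_odd
     first_last_even first_third_even first_last_le first_third_le w1_equation).
- exact: (three_slot_odd d_ge16 t1_odd t2_odd
     first_third_even first_second_even first_third_le first_second_le w3_equation).
- apply: (three_slot_even d_ge16 t2_odd t3_odd
     first_last_even first_third_even first_last_le first_third_le w1_equation).
  + exact: even1.
  + by apply: first_last_odd => //; exact: odd2.
  + by apply: first_third_odd => //; exact: odd2.
- apply: (three_slot_even d_ge16 t1_odd t2_odd
     first_third_even first_second_even first_third_le first_second_le w3_equation).
  + exact: even1.
  + by apply: first_third_odd => //; exact: odd2.
  + by apply: first_second_odd => //; exact: odd2.
Qed.

End slot_reduction.

(** * Permutations near the 4-cycle and the final bound *)

Local Ltac perm4_values :=
  rewrite /cycle4 /double_swap ?conjMg ?tpermJ ?permM ?permE /=;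
  let k := fresh in apply/permP => k; rewrite ?permM;
  case: (ord4P k) => ->; rewrite ?permE /=.

Lemma t02_cycle4 : (tperm o0 o2 * cycle4 = double_swap)%g.
Proof. by perm4_values. Qed.

Lemma t13_cycle4 : (tperm o1 o3 * cycle4 = double_swap ^ tperm o1 o3)%g.
Proof. by perm4_values. Qed.

Lemma t13_t02_cycle4 : (tperm o1 o3 * (tperm o0 o2 * cycle4) = cycle4 ^ tperm o1 o3)%g.
Proof. by perm4_values. Qed.

Lemma t03_t02_t01_cycle4 :
  (tperm o0 o3 * (tperm o0 o2 * (tperm o0 o1 * cycle4)) = double_swap ^ tperm o1 o2)%g.
Proof. by perm4_values. Qed.

Lemma fixed_points_cycle4 :
  [/\ (tperm o1 o3 * (tperm o0 o2 * (tperm o0 o1 * cycle4)))%g o3 = o3,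
      (tperm o1 o3 * (tperm o0 o2 * (tperm o0 o3 * cycle4)))%g o2 = o2,
      (tperm o0 o2 * (tperm o0 o3 * (tperm o0 o1 * cycle4)))%g o2 = o2,
      (tperm o0 o2 * (tperm o0 o1 * (tperm o0 o3 * cycle4)))%g o3 = o3 &
      (tperm o0 o1 * (tperm o0 o2 * (tperm o0 o3 * cycle4)))%g o0 = o0].
Proof. by split; rewrite /cycle4 !permM !permE. Qed.

(** By cyclicity of the trace, a [U] passes from one end of the product to the other, and the [U]s
    regroup around [A] and [C] instead of [B] and [D]. *)
Lemma haar_otoc8E (R : realType) (d : nat) (mu : probability (unitary_borel R d) R)
    (A B C D : 'M[R[i]]_d) :
  A^t* = A -> B^t* = B -> C^t* = C -> D^t* = D ->
  haar_otoc8 mu A B C D =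
  d%:R^-1 * correlator mu (slots B D D B) (slots A C A C) cycle4.
Proof.
move=> Aadj Badj Cadj Dadj.
have heis_adj U (O : 'M[R[i]]_d) : O^t* = O -> (heis U O)^t* = heis U O.
  by move=> Oadj; rewrite /heis !trmx_mul !map_mxM -/(O^t* ) Oadj trmxCK mulmxA.
rewrite correlatorE -cintegralZ; last first.
  apply: cbm_sum => f _; apply: cbm_prod => k _; apply: cbm_mulmx => i j.
    exact: cbm_uconj.
  exact: cbm_cst.
congr cintegral; apply/funext => U; congr (_ * _).
rewrite twisted_trace_cycle4 /slots /= !heis_adj // Aadj Cadj.
rewrite /heis /uconj; move: (val U) ((val U)^t*) => V W.
by rewrite -!mulmxA [RHS]mxtrace_mulC -!mulmxA.
Qed.

Theorem mainTheorem8 (R : realType) :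
  exists K : R, \forall n \near \oo,
    forall (mu : probability (unitary_borel R (2 ^ n)) R)
      (A B C D : 'M[R[i]]_(2 ^ n)),
    is_haar mu ->
    pauli_operator A -> pauli_operator B ->
    pauli_operator C -> pauli_operator D ->
    A <> 1%:M -> B <> 1%:M -> C <> 1%:M -> D <> 1%:M ->
    A *m C <> 1%:M -> B *m D <> 1%:M ->
    `|haar_otoc8 mu A B C D| <= (K * (((2 ^ n)%N%:R : R) ^- 4))%:C.
Proof.
(* The constant is that of [slot_reduction_bound]; [n >= 4] ensures [d >= 16]. *)
exists 399%:R; exists 4%N => // n /= n_ge4 mu A B C D mu_haar.
move=> pA pB pC pD A1 B1 C1 D1 AC1 BD1.
have d_ge16 : (16 <= 2 ^ n)%N by rewrite -[16%N]/(2 ^ 4)%N leq_exp2l.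
have [[[AA BB] CC] DD] := (pauli_operator_sqr pA, pauli_operator_sqr pB,
  pauli_operator_sqr pC, pauli_operator_sqr pD).
have BD_tr := pauli_operator_orthogonal pB pD BD1.
have DB_tr : \tr (D *m B) = 0 by rewrite mxtrace_mulC.
have CA_tr : \tr (C *m A) = 0 by rewrite mxtrace_mulC pauli_operator_orthogonal.
pose S := slots B D D B.
have S_unitary k : S k \is unitarymx.
  by case: (ord4P k) => ->; exact: pauli_operator_unitary.
have S_tr k : \tr (S k) = 0.
  by case: (ord4P k) => ->; exact: pauli_operator_traceless.
have [f1 f2 f3 f4 f5] := fixed_points_cycle4.
have bound : ((2 ^ n)%:R : R) ^+ 3 * ComplexField.Normc.normc
    (correlator mu S (slots A C A C) cycle4) <= 399%:R.
  apply: (@slot_reduction_bound R (2 ^ n) 4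
    (fun X0 X1 X2 X3 p => correlator mu S (slots X0 X1 X2 X3) p)
    (tperm o0 o1) (tperm o0 o2) (tperm o0 o3) (tperm o1 o3) (tperm o1 o2)
    cycle4 (twisted_trace S) (slot0_equation mu_haar S) (slot1_equation mu_haar S)
    (correlator_slots1 mu S) d_ge16 A C);
    rewrite ?odd_tperm ?odd_cycle4 ?tperm2 //.
  - exact: pauli_operator_unitary.
  - exact: pauli_operator_unitary.
  - exact: pauli_operator_traceless.
  - exact: pauli_operator_traceless.
  - by move=> p; apply: twisted_trace_le => //; rewrite expn_gt0.
  - exact: twisted_trace_odd.
  - by rewrite twisted_trace_cycle4 /S /slots /= -!mulmxA (mulmxA D) DD mul1mx BB mxtrace1.
  (* This permutation pairs equal matrices, giving [tr (B B) * tr (D D) = d ^ 2]; the next one pairs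
     [B] with [D] and gives zero. *)
  - rewrite t13_cycle4 twisted_trace_conj twisted_trace_double_swap /=.
    by rewrite !(tpermL, tpermR, tpermD) //= BB DD mxtrace1 expr2.
  - by rewrite t02_cycle4 twisted_trace_double_swap /S /slots /= BD_tr mul0r.
  - rewrite t13_t02_cycle4 twisted_trace_conj twisted_trace_cycle4 /=.
    by rewrite !(tpermL, tpermR, tpermD) //= /S /slots /= BB mul1mx DD mxtrace1.
  - exact: twisted_trace_fixed f1 (S_tr _).
  - exact: twisted_trace_fixed f2 (S_tr _).
  - rewrite t03_t02_t01_cycle4 twisted_trace_conj twisted_trace_double_swap /=.
    by rewrite !(tpermL, tpermR, tpermD) //= /S /slots /= BD_tr mul0r.
  - exact: twisted_trace_fixed f3 (S_tr _).
  - exact: twisted_trace_fixed f4 (S_tr _).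
  - exact: twisted_trace_fixed f5 (S_tr _).
have [[[dA dB] dC] dD] := (pauli_operator_adj pA, pauli_operator_adj pB,
  pauli_operator_adj pC, pauli_operator_adj pD).
rewrite (haar_otoc8E mu dA dB dC dD) normrM normfV normr_nat.
have d0 : 0 < ((2 ^ n)%:R : R) by rewrite ltr0n expn_gt0.
rewrite -[X in _ * X]/((ComplexField.Normc.normc _)%:C) -(rmorph_nat (real_complex R)).
rewrite -fmorphV -rmorphM lecR.
rewrite ler_pdivrMl // mulrCA.
(* The normalisation [1 / d] of the trace turns the order [d ^ -3] into [d ^ -4]. *)
rewrite [X in _ * X](_ : _ = ((2 ^ n)%:R ^+ 3)^-1); last first.
  by rewrite [_ ^+ 4]exprS invfM mulrA mulfV ?mul1r ?gt_eqF.
by rewrite ler_pdivlMr ?exprn_gt0 // mulrC.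
Qed.
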